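(* Let $J$ be any left-invariant complex structure on the real Lie group $\mathrm{SL}(2,\mathbb C)$ and let $\Gamma$ be any cocompact lattice of $\mathrm{SL}(2,\mathbb C)$. Then the compact complex manifold $(\Gamma\backslash\mathrm{SL}(2,\mathbb C),J)$ admits a balanced metric.
   Context: $\mathrm{SL}(2,\mathbb C)$ is viewed as a real Lie group of real dimension $6$. A left-invariant complex structure $J$ is an integrable complex structure for which all left translations are biholomorphisms; it descends to a complex structure, also denoted $J$, on $\Gamma\backslash\mathrm{SL}(2,\mathbb C)$. A Hermitian metric $g$ on a complex manifold $(M,J)$ of real dimension $2n$ is balanced if the $2$-form $\omega(\cdot,\cdot)=g(J\cdot,\cdot)$ satisfies $d\omega^{n-1}=0$. *)

(* Defs.v *)
From HB Require Import structures.
From mathcomp Require Import all_boot all_order all_algebra all_fingroup.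
From mathcomp Require Import generic_quotient.
From mathcomp Require Import complex.
From mathcomp Require Import all_classical all_reals all_analysis.
Set Implicit Arguments.
Unset Strict Implicit.
Unset Printing Implicit Defensive.
Import Order.TTheory GRing.Theory Num.Theory.
Import numFieldNormedType.Exports.
Local Open Scope classical_set_scope.
Local Open Scope complex_scope.
Local Open Scope ring_scope.

(* The alias [R[i]^o] carries the usual topology of the complex numbers, so
   that [M2C R] has the usual topology of C^4 = R^8. *)
Notation M2C R := 'M[R[i]^o]_2.

Section SmoothFunctions.
Variable R : realType.
Local Notation V := (M2C R).

(* Derivative along the real line t |-> p + t v: all differentiability below is
   over the reals. *)
Definition along (f : V -> R) (p v : V) (t : R) : R := f (p + t%:C *: v).

Definition dirder (f : V -> R) (v p : V) : R := derive1 (along f p v) 0.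

(* Class C^n on an open set, through iterated real directional derivatives. *)
Fixpoint class_C (n : nat) (U : set V) (f : V -> R) : Prop :=
  {in U, continuous f} /\
  (if n is m.+1 then
     forall v, (forall p, U p -> derivable (along f p v) 0 1)
               /\ class_C m U (dirder f v)
   else True).

Definition smooth_on (U : set V) (f : V -> R) : Prop :=
  forall n, class_C n U f.

Definition matrix_dirder (X : V -> V) (v p : V) : V :=
  \matrix_(i, j) (dirder (fun q => complex.Re (X q i j)) v p
               +i* dirder (fun q => complex.Im (X q i j)) v p).

End SmoothFunctions.

(* SL(2,C) is treated as an embedded real submanifold of M_2(C) = R^8: functions
   and tensor fields on it are smooth when they extend smoothly to an open
   neighbourhood of SL(2,C) in M_2(C). *)
Section SpecialLinear.
Variable R : realType.
Local Notation V := (M2C R).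

Definition SL2 : set V := [set p | \det p = 1].

(* The kernel of the differential of \det at p, that is p *m sl(2,C). *)
Definition tangent (p : V) : set V := [set v | \tr (invmx p *m v) = 0].

Definition smooth_near (f : V -> R) : Prop :=
  exists U : set V, [/\ open U, SL2 `<=` U & smooth_on U f].

Definition smooth_SL2 (f : V -> R) : Prop :=
  exists2 F, smooth_near F & forall p, SL2 p -> F p = f p.

(* A vector field on SL(2,C), given together with a smooth extension to a
   neighbourhood. *)
Definition vector_field (X : V -> V) : Prop :=
  (forall p, SL2 p -> tangent p (X p)) /\
  forall i j, smooth_near (fun q => complex.Re (X q i j)) /\
              smooth_near (fun q => complex.Im (X q i j)).

(* On SL(2,C) this depends only on the restrictions of X and Y to SL(2,C), the
   derivatives being taken in tangent directions. *)
Definition bracket (X Y : V -> V) (p : V) : V :=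
  matrix_dirder Y (X p) p - matrix_dirder X (Y p) p.

End SpecialLinear.

Section Forms.
Variable R : realType.
Local Notation V := (M2C R).

Definition form (k : nat) := V -> ('I_k -> V) -> R.

Definition setarg k (v : 'I_k -> V) (i : 'I_k) (u : V) : 'I_k -> V :=
  fun j => if j == i then u else v j.

Definition multilinear k (f : ('I_k -> V) -> R) : Prop :=
  forall v i (a : R) u w,
    f (setarg v i (a%:C *: u + w)) = a * f (setarg v i u) + f (setarg v i w).

Definition alternating k (f : ('I_k -> V) -> R) : Prop :=
  forall v i j, i != j -> v i = v j -> f v = 0.

Definition wedge k l (a : form k) (b : form l) : form (k + l) :=
  fun p v => ((k`! * l`!)%N%:R)^-1 *
    \sum_(s : 'S_(k + l)) (-1) ^+ s *
      (a p (fun i => v (s (lshift l i))) * b p (fun j => v (s (rshift k j)))).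

Fixpoint wedge_pow (w : form 2) (n : nat) : form (n * 2) :=
  if n is m.+1 then wedge w (@wedge_pow w m) else fun _ _ => 1.

(* Exterior derivative in the flat space M_2(C). *)
Definition ext_d k (a : form k) : form k.+1 :=
  fun p v => \sum_(i < k.+1)
    (-1) ^+ i * dirder (fun q => a q (fun j => v (lift i j))) (v i) p.

Definition smooth_form_near k (a : form k) : Prop :=
  exists U : set V,
    [/\ open U, @SL2 R `<=` U,
        forall p, U p -> multilinear (a p) /\ alternating (a p)
      & forall v, smooth_on U (a ^~ v)].

(* A form on SL(2,C) is only relevant on tangent vectors at points of SL(2,C).
   As the exterior derivative commutes with restriction to a submanifold, the
   differential of such a form is the restriction of the differential of any of
   its smooth extensions. *)
Definition closed_SL2 k (b : form k) : Prop :=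
  exists a : form k,
    [/\ smooth_form_near a,
        forall p v, SL2 p -> (forall i, tangent p (v i)) -> a p v = b p v
      & forall p v, SL2 p -> (forall i, tangent p (v i)) -> ext_d a p v = 0].

End Forms.

Arguments wedge_pow {R} w n.

Section ComplexStructures.
Variable R : realType.
Local Notation V := (M2C R).

(* [J p v] is the value of J at the tangent vector v to SL(2,C) at p; other
   values are irrelevant. *)
Record almost_complex (J : V -> V -> V) : Prop := AlmostComplex {
  ac_tangent : forall p v, SL2 p -> tangent p v -> tangent p (J p v);
  ac_linear : forall p (a : R) u v, SL2 p -> tangent p u -> tangent p v ->
    J p (a%:C *: u + v) = a%:C *: J p u + J p v;
  ac_square : forall p v, SL2 p -> tangent p v -> J p (J p v) = - v;
  ac_smooth : forall X, vector_field X ->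
    exists2 JX, vector_field JX & forall p, SL2 p -> JX p = J p (X p)
}.

(* Vanishing of the Nijenhuis tensor; JX and JY are extensions of the vector
   fields J X and J Y of SL(2,C). *)
Definition integrable_ac (J : V -> V -> V) : Prop :=
  forall X Y JX JY : V -> V,
    vector_field X -> vector_field Y -> vector_field JX -> vector_field JY ->
    (forall p, SL2 p -> JX p = J p (X p)) ->
    (forall p, SL2 p -> JY p = J p (Y p)) ->
    forall p, SL2 p ->
      bracket X Y p + J p (bracket JX Y p) + J p (bracket X JY p)
        - bracket JX JY p = 0.

(* The left translation by g is the restriction of a linear map of M_2(C), hence
   its differential is v |-> g *m v. *)
Definition left_invariant (J : V -> V -> V) : Prop :=
  forall g p v, SL2 g -> SL2 p -> tangent p v ->
    J (g *m p) (g *m v) = g *m J p v.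

Definition left_invariant_complex_structure (J : V -> V -> V) : Prop :=
  [/\ almost_complex J, integrable_ac J & left_invariant J].

End ComplexStructures.

Section Lattices.
Variable R : realType.
Local Notation V := (M2C R).

Record subgroup_SL2 := SubgroupSL2 {
  subgroup_set : set V;
  subgroup_sub : subgroup_set `<=` @SL2 R;
  subgroup1 : subgroup_set 1%:M;
  subgroupM : forall g h, subgroup_set g -> subgroup_set h ->
    subgroup_set (g *m h);
  subgroupV : forall g, subgroup_set g -> subgroup_set (invmx g)
}.

Variable Gamma : subgroup_SL2.

Definition same_orbit (p q : @SL2 R) : bool :=
  `[< exists2 g, subgroup_set Gamma g & set_val q = g *m set_val p >].

Lemma same_orbit_equiv : equiv_class_of same_orbit.
Proof.
have unitG g : subgroup_set Gamma g -> g \in unitmx.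
  by move=> /subgroup_sub Gg; rewrite unitmxE Gg unitr1.
split.
- by move=> p; apply/asboolP; exists 1%:M; [exact: subgroup1|rewrite mul1mx].
- have sym p q : same_orbit p q -> same_orbit q p.
    move=> /asboolP[g Gg pq]; apply/asboolP; exists (invmx g).
      exact: subgroupV.
    by rewrite pq mulKmx// unitG.
  by move=> p q; apply/idP/idP; exact: sym.
- move=> q p r /asboolP[g Gg pq] /asboolP[h Gh qr]; apply/asboolP.
  exists (h *m g); first exact: subgroupM.
  by rewrite qr pq mulmxA.
Qed.

Canonical same_orbit_equiv_rel := EquivRelPack same_orbit_equiv.

Definition quotient_SL2 : topologicalType :=
  quotient_topology {eq_quot same_orbit_equiv_rel}%qT.

Definition cocompact_lattice : Prop :=
  (forall g, subgroup_set Gamma g -> isolated (subgroup_set Gamma) g) /\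
  compact [set: quotient_SL2].

End Lattices.

Section BalancedMetrics.
Variable R : realType.
Local Notation V := (M2C R).

(* Since a lattice Gamma acts on SL(2,C) freely and properly discontinuously by
   left translations, the tensor fields on Gamma\SL(2,C) are, by pullback along
   the covering map, the Gamma-invariant tensor fields on SL(2,C).
   [h p u v] is the value at p of such a field on tangent vectors u and v. *)
Record hermitian_metric (Gamma : subgroup_SL2 R) (J : V -> V -> V)
    (h : V -> V -> V -> R) : Prop := HermitianMetric {
  hm_linear : forall p (a : R) u v w,
    SL2 p -> tangent p u -> tangent p v -> tangent p w ->
    h p (a%:C *: u + v) w = a * h p u w + h p v w;
  hm_sym : forall p u v, SL2 p -> tangent p u -> tangent p v ->
    h p u v = h p v u;
  hm_pos : forall p u, SL2 p -> tangent p u -> u != 0 -> 0 < h p u u;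
  hm_smooth : forall X Y, vector_field X -> vector_field Y ->
    smooth_SL2 (fun p => h p (X p) (Y p));
  hm_invariant : forall g p u v, subgroup_set Gamma g -> SL2 p ->
    tangent p u -> tangent p v ->
    h (g *m p) (g *m u) (g *m v) = h p u v;
  hm_J : forall p u v, SL2 p -> tangent p u -> tangent p v ->
    h p (J p u) (J p v) = h p u v
}.

Definition fundamental_form (J : V -> V -> V) (h : V -> V -> V -> R) :
    form R 2 :=
  fun p v => h p (J p (v ord0)) (v ord_max).

(* The manifold has real dimension 2n with n = 3; the covering map being a local
   diffeomorphism, closedness can be tested on SL(2,C). *)
Definition balanced_metric (Gamma : subgroup_SL2 R) (J : V -> V -> V)
    (h : V -> V -> V -> R) : Prop :=
  hermitian_metric Gamma J h /\
  closed_SL2 (wedge_pow (fundamental_form J h) 3.-1).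

End BalancedMetrics.

(* Main.v *)
Require Import Defs.
From mathcomp Require Import all_boot all_order all_algebra all_fingroup.
From mathcomp Require Import all_classical all_reals all_analysis.
From mathcomp Require Import complex ring lra.
Set Implicit Arguments.
Unset Strict Implicit.
Unset Printing Implicit Defensive.
Import Order.TTheory GRing.Theory Num.Theory.
Import numFieldNormedType.Exports.
Local Open Scope classical_set_scope.
Local Open Scope complex_scope.
Local Open Scope ring_scope.

(* A left-invariant complex structure J always preserves three
   complex lines spanning sl(2,C) (complex for the standard structure i). Let n1
   and n2 be the eigenspaces of J for i and -i. By integrability n1 is normalised
   by the image of 1 - iJ and n2 by that of 1 + iJ. If n2 = 0 then n1 is an ideal,
   hence 0 or everything; n1 = n2 = 0 is impossible; and if both are nonzero, but
   do not span, then they are lines, and the image of the antilinear part of J is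
   a third J-stable line, which is not in n1 + n2.

   Let z1, z2, z3 be the complex coordinates attached to three such lines, and
   take the left-invariant metric with fundamental form
   w = sum_k s_k (i/2) z_k /\ conj z_k, where the sign s_k is the orientation
   given by J on the k-th line. Then w^2 is a combination of the forms
   P /\ conj P with P = z_k /\ z_l. Since every alternating complex bilinear form
   on sl(2,C) factors through the bracket, P is the restriction of the form
   tr (c (adj(u) v - adj(v) u)) in u and v, which does not depend on the point of
   M_2(C): so w^2 is the restriction of a form with constant coefficients, and is
   closed. *)

(** * The Lie algebra given by the cross product in dimension three *)

Section CrossProduct.
Variable F : numFieldType.
Implicit Types (x y z : 'rV[F]_3) (A : 'M[F]_3).

Definition e0 : 'I_3 := @Ordinal 3 0 isT.
Definition e1 : 'I_3 := @Ordinal 3 1 isT.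
Definition e2 : 'I_3 := @Ordinal 3 2 isT.

Lemma ord3P (P : 'I_3 -> Prop) : P e0 -> P e1 -> P e2 -> forall k, P k.
Proof.
move=> P0 P1 P2 [[|[|[|k]]] hk] //.
- by rewrite (_ : Ordinal hk = e0) //; apply: val_inj.
- by rewrite (_ : Ordinal hk = e1) //; apply: val_inj.
- by rewrite (_ : Ordinal hk = e2) //; apply: val_inj.
Qed.

Lemma row3P x y :
  x 0 e0 = y 0 e0 -> x 0 e1 = y 0 e1 -> x 0 e2 = y 0 e2 -> x = y.
Proof. by move=> h0 h1 h2; apply/rowP; apply: ord3P. Qed.

Lemma sum3 (V : nmodType) (f : 'I_3 -> V) :
  \sum_(k < 3) f k = f e0 + f e1 + f e2.
Proof.
rewrite !big_ord_recr big_ord0 /= add0r.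
by congr (f _ + f _ + f _); apply: val_inj.
Qed.

Definition row3 (a b c : F) : 'rV[F]_3 := \row_k nth 0 [:: a; b; c] k.

Definition cross x y : 'rV[F]_3 :=
  row3 (x 0 e1 * y 0 e2 - x 0 e2 * y 0 e1)
       (x 0 e2 * y 0 e0 - x 0 e0 * y 0 e2)
       (x 0 e0 * y 0 e1 - x 0 e1 * y 0 e0).

Definition dot x y : F := x 0 e0 * y 0 e0 + x 0 e1 * y 0 e1 + x 0 e2 * y 0 e2.

Lemma crossDl x y z : cross (x + y) z = cross x z + cross y z.
Proof. by apply: row3P; rewrite !mxE /=; ring. Qed.

Lemma crossDr x y z : cross z (x + y) = cross z x + cross z y.
Proof. by apply: row3P; rewrite !mxE /=; ring. Qed.

Lemma crossZl c x y : cross (c *: x) y = c *: cross x y.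
Proof. by apply: row3P; rewrite !mxE /=; ring. Qed.

Lemma crossZr c x y : cross x (c *: y) = c *: cross x y.
Proof. by apply: row3P; rewrite !mxE /=; ring. Qed.

Lemma crossC x y : cross y x = - cross x y.
Proof. by apply: row3P; rewrite !mxE /=; ring. Qed.

Lemma crossNl x y : cross (- x) y = - cross x y.
Proof. by apply: row3P; rewrite !mxE /=; ring. Qed.

Lemma crossNr x y : cross x (- y) = - cross x y.
Proof. by apply: row3P; rewrite !mxE /=; ring. Qed.

Lemma crossxx x : cross x x = 0.
Proof. by apply: row3P; rewrite !mxE /=; ring. Qed.

Lemma cross_cross x y : cross x (cross x y) = dot x y *: x - dot x x *: y.
Proof. by apply: row3P; rewrite !mxE /= /dot; ring. Qed.

Lemma dot_cross x y : dot x (cross x y) = 0.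
Proof. by rewrite /dot !mxE /=; ring. Qed.

Lemma dotDl x y z : dot (x + y) z = dot x z + dot y z.
Proof. by rewrite /dot !mxE; ring. Qed.

Lemma dotZl c x y : dot (c *: x) y = c * dot x y.
Proof. by rewrite /dot !mxE; ring. Qed.

Lemma dotNl x y : dot (- x) y = - dot x y.
Proof. by rewrite -scaleN1r dotZl mulN1r. Qed.

Lemma dotZr c x y : dot x (c *: y) = c * dot x y.
Proof. by rewrite /dot !mxE /=; ring. Qed.

Lemma row3_eq0 x : (forall k, x 0 k = 0) -> x = 0.
Proof. by move=> h; apply/rowP=> k; rewrite h mxE. Qed.

Lemma nz_coord x : x != 0 -> exists k, x 0 k != 0.
Proof.
move=> nz; apply/existsP; apply: contraNT nz => /existsPn h.
by apply/eqP/row3_eq0 => k; apply/eqP; move: (h k); rewrite negbK.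
Qed.

Lemma cross_eq0 x y : x != 0 -> cross x y = 0 -> exists c, y = c *: x.
Proof.
move=> /nz_coord[k xk] xy; exists (y 0 k / x 0 k).
have h j : cross x y 0 j = 0 by rewrite xy mxE.
move: (h e0) (h e1) (h e2); rewrite !mxE /= => h0 h1 h2.
suff q j : x 0 k * y 0 j = x 0 j * y 0 k.
  apply/rowP => j; rewrite mxE; apply: (mulfI xk); rewrite q; field.
  exact: xk.
have q01 : x 0 e0 * y 0 e1 = x 0 e1 * y 0 e0 by apply/eqP; rewrite -subr_eq0 h2.
have q12 : x 0 e1 * y 0 e2 = x 0 e2 * y 0 e1 by apply/eqP; rewrite -subr_eq0 h0.
have q20 : x 0 e2 * y 0 e0 = x 0 e0 * y 0 e2 by apply/eqP; rewrite -subr_eq0 h1.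
by move: k j {xk}; apply: ord3P; apply: ord3P.
Qed.

(** Simplicity of the cross-product algebra: [cross (cross x w) v = dot x v *: w - dot w v *: x], so
    a [v] with [dot x v = 1] puts every [w] in an ideal containing [x]. *)
Lemma ideal_full (P : 'rV[F]_3 -> Prop) x :
  (forall a b, P a -> P b -> P (a + b)) -> (forall c a, P a -> P (c *: a)) ->
  x != 0 -> P x -> (forall a w, P a -> P (cross a w)) -> forall w, P w.
Proof.
move=> PD PZ /nz_coord[k xk] Px Pc w.
pose b : 'rV[F]_3 := (x 0 k)^-1 *: delta_mx 0 k.
have xb : dot x b = 1.
  rewrite dotZr -(mulVf xk); congr (_ * _); rewrite /dot !mxE.
  by move: k {xk b}; apply: ord3P; rewrite /=; ring.
have g v : dot x v *: w = cross (cross x w) v + dot w v *: x.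
  by apply: row3P; rewrite !mxE /= /dot; ring.
rewrite -[w]scale1r -xb g.
by apply: PD; [apply/Pc/Pc|exact: PZ].
Qed.

Lemma unitmx_row_inj n (A : 'M[F]_n) :
  (forall v : 'rV_n, v *m A = 0 -> v = 0) -> A \in unitmx.
Proof.
move=> inj; rewrite -row_free_unit -kermx_eq0; apply/eqP/row_matrixP => i.
by rewrite row0; apply: inj; apply/sub_kermxP/row_sub.
Qed.

Lemma linear_matrix m n (f : 'rV[F]_m -> 'rV[F]_n) :
  (forall u v, f (u + v) = f u + f v) -> (forall c u, f (c *: u) = c *: f u) ->
  exists A : 'M[F]_(m, n), forall u, f u = u *m A.
Proof.
move=> fD fZ; have f0 : f 0 = 0 by rewrite -(scale0r 0) fZ scale0r.
exists (\matrix_i f (delta_mx 0 i)) => u.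
rewrite [in LHS](row_sum_delta u) (big_morph f fD f0) mulmx_sum_row.
by apply: eq_bigr => i _; rewrite fZ rowK.
Qed.

Definition mat3 x y z : 'M[F]_3 := \matrix_i nth 0 [:: x; y; z] i.

Lemma mul_mat3 v x y z :
  v *m mat3 x y z = v 0 e0 *: x + v 0 e1 *: y + v 0 e2 *: z.
Proof. by rewrite mulmx_sum_row sum3 !rowK. Qed.

Lemma mat3_unit x y z :
  (forall a b c, a *: x + b *: y + c *: z = 0 -> [/\ a = 0, b = 0 & c = 0]) ->
  mat3 x y z \in unitmx.
Proof.
move=> h; apply: unitmx_row_inj => v; rewrite mul_mat3 => /h[v0 v1 v2].
by apply: row3P; rewrite mxE.
Qed.

Lemma mat3_span x y z w : mat3 x y z \in unitmx ->
  exists a b c, w = a *: x + b *: y + c *: z.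
Proof.
move=> u; pose v := w *m invmx (mat3 x y z).
by exists (v 0 e0), (v 0 e1), (v 0 e2); rewrite -mul_mat3 mulmxKV.
Qed.

(** [cross_cross] recovers the scalar product from the bracket: an automorphism respects
    [cross a (cross a b)], and the coefficients on the independent vectors [a] and [b] can be
    compared. *)
Lemma cross_automorphism_orthogonal A : A \in unitmx ->
  (forall a b, cross (a *m A) (b *m A) = cross a b *m A) ->
  forall a b, cross a b != 0 ->
  dot (a *m A) (b *m A) = dot a b /\ dot (a *m A) (a *m A) = dot a a.
Proof.
move=> uA hA a b ab0; set D := dot (a *m A) (b *m A); set E := dot (a *m A) _.
have : (D - dot a b) *: a = (E - dot a a) *: b.
  apply: (can_inj (mulmxK uA)); have := cross_cross (a *m A) (b *m A).
  rewrite !hA cross_cross mulmxBl -!scalemxAl -/D -/E !scalerBl => h.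
  apply/eqP; rewrite -subr_eq0 opprB [X in _ + X]addrC addrACA -h.
  by rewrite [X in _ + X]addrC -[X in _ + X]opprB subrr.
move=> h; have q : (E - dot a a) *: cross a b = 0.
  by rewrite -crossZr -h crossZr crossxx scaler0.
have r : (D - dot a b) *: cross a b = 0.
  by rewrite -crossZl h crossZl crossxx scaler0.
move: q r => /eqP; rewrite scaler_eq0 (negPf ab0) orbF subr_eq0 => /eqP ->.
by move/eqP; rewrite scaler_eq0 (negPf ab0) orbF subr_eq0 => /eqP ->.
Qed.

Lemma det3 A : \det A = dot (cross (row e0 A) (row e1 A)) (row e2 A).
Proof.
rewrite (expand_det_row _ e0) sum3 /cofactor !(expand_det_row _ 0).
rewrite !big_ord_recr !big_ord0 /= /cofactor !det_mx11 !mxE /dot !mxE /=.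
(* Indexing the entries by natural numbers identifies ordinals that differ only by their bound
   proofs. *)
pose a (i j : nat) := A (inord i) (inord j).
have aE i j : A i j = a i j by rewrite /a !inord_val.
clearbody a; rewrite !aE /= /bump /=; ring.
Qed.

(** [A] is orthogonal of determinant 1 in odd dimension, so [det (A - 1) = det A * det (1 - A^T) = -
    det (A - 1)] and 1 is an eigenvalue. *)
Lemma cross_automorphism_fixed A : A \in unitmx ->
  (forall a b, cross (a *m A) (b *m A) = cross a b *m A) ->
  exists2 a : 'rV[F]_3, a != 0 & a *m A = a.
Proof.
move=> uA hA.
have row3neq0 (v : 'rV[F]_3) k : v 0 k != 0 -> v != 0.
  by apply: contraNneq => ->; rewrite mxE.
pose d j : 'rV[F]_3 := delta_mx 0 j.
have dE i j : dot (row i A) (row j A) = (i == j)%:R.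
  rewrite !rowE.
  have D := cross_automorphism_orthogonal uA hA.
  have {D}[D1 D2 D3] : [/\ forall i j, i != j -> cross (d i) (d j) != 0,
     forall i j, i != j -> dot (d i *m A) (d j *m A) = dot (d i) (d j) &
     forall i, dot (d i *m A) (d i *m A) = dot (d i) (d i)].
    have D1 k l : k != l -> cross (d k) (d l) != 0.
      by move: k l; apply: ord3P; apply: ord3P => // _;
        [apply: (row3neq0 _ e2)|apply: (row3neq0 _ e1)|apply: (row3neq0 _ e2)
        |apply: (row3neq0 _ e0)|apply: (row3neq0 _ e1)|apply: (row3neq0 _ e0)];
        rewrite !mxE /= ?mulr0 ?mul0r ?mulr1 ?subr0 ?sub0r ?oppr_eq0 oner_eq0.
    split=> // [k l kl|k]; first by case: (D _ _ (D1 _ _ kl)).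
    have [l kl] : exists l, k != l.
      by move: k; apply: ord3P; [exists e1|exists e0|exists e0].
    by case: (D _ _ (D1 _ _ kl)).
  have dd : dot (d i) (d j) = (i == j)%:R.
    by rewrite /dot !mxE; move: i j; apply: ord3P; apply: ord3P => /=; ring.
  rewrite -dd; case: (eqVneq i j) => [->|ij]; [exact: D3|exact: D2].
have AAt : A *m A^T = 1%:M.
  apply/matrixP => i j; rewrite [RHS]mxE -dE mxE sum3 /dot.
  by rewrite !mxE.
(* The cross product of the first two rows is the third, so the triple product is the scalar square
   of the third row. *)
have detA : \det A = 1.
  rewrite det3 !rowE hA (_ : cross _ _ = delta_mx 0 e2) -?rowE ?dE ?eqxx //.
  by apply: row3P; rewrite !mxE /=; ring.
have : - \det (A - 1%:M) == \det (A - 1%:M).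
  rewrite -{2}AAt -{2}[A]mulmx1 -mulmxBr det_mulmx detA mul1r.
  rewrite -[X in _ == X]det_tr linearB /= trmxK tr_scalar_mx.
  by rewrite -[1%:M - A]opprB -[- (A - _)]scaleN1r detZ -signr_odd /= expr1 mulN1r.
rewrite eqNr => /det0P[v nz]; rewrite mulmxBr mulmx1 => /eqP.
by rewrite subr_eq0 => /eqP; exists v.
Qed.
End CrossProduct.

(** * Real-linear maps of complex vector spaces *)

Section RealLinear.
Variable R : rcfType.
Local Notation C := R[i].

Definition im : C := 'i%C.

Lemma complexIE (c : C) : c = (complex.Re c)%:C + im * (complex.Im c)%:C.
Proof. exact: complexE. Qed.

Lemma im2 : im * im = -1.
Proof. by rewrite /im -expr2 sqr_i. Qed.

Definition conjmx m n (A : 'M[C]_(m, n)) : 'M[C]_(m, n) := map_mx (@conjc R) A.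

Lemma conjmxK m n : involutive (@conjmx m n).
Proof. by move=> A; apply/matrixP => i j; rewrite !mxE conjcK. Qed.

Lemma conjmxD m n (A B : 'M[C]_(m, n)) : conjmx (A + B) = conjmx A + conjmx B.
Proof. exact: map_mxD. Qed.

Lemma conjmxM m n p (A : 'M[C]_(m, n)) (B : 'M[C]_(n, p)) :
  conjmx (A *m B) = conjmx A *m conjmx B.
Proof. exact: map_mxM. Qed.

Lemma conjmxZ m n c (A : 'M[C]_(m, n)) : conjmx (c *: A) = (conjc c) *: conjmx A.
Proof. by apply/matrixP => i j; rewrite !mxE rmorphM. Qed.

Lemma conj_im : conjc im = - im.
Proof. by rewrite /im /conjc; apply/eqP; rewrite eq_complex /= oppr0 !eqxx. Qed.

Definition real_linear n (f : 'rV[C]_n -> 'rV[C]_n) : Prop :=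
  (forall x y, f (x + y) = f x + f y) /\
  (forall (a : R) x, f (a%:C *: x) = a%:C *: f x).

Section Theory.
Variables (n : nat) (f : 'rV[C]_n -> 'rV[C]_n).
Hypothesis lf : real_linear f.

Implicit Types (x y : 'rV[C]_n) (c : C).

Lemma rlD x y : f (x + y) = f x + f y. Proof. by case: lf => h _; exact: h. Qed.

Lemma rlZr (a : R) (x : 'rV[C]_n) : f (a%:C *: x) = a%:C *: f x.
Proof. by case: lf => _; exact. Qed.

Lemma rl0 : f 0 = 0.
Proof. by have := rlZr 0 0; rewrite !scale0r. Qed.

Lemma rlN x : f (- x) = - f x.
Proof. by apply/eqP; rewrite -addr_eq0 -rlD addNr rl0. Qed.

Lemma rlB x y : f (x - y) = f x - f y.
Proof. by rewrite rlD rlN. Qed.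

Lemma rlZ (c : C) (x : 'rV[C]_n) : f (c *: x) = (complex.Re c)%:C *: f x + (complex.Im c)%:C *: f (im *: x).
Proof.
by rewrite -!rlZr -rlD scalerA -scalerDl [_%:C * im]mulrC -complexIE.
Qed.

Lemma rl_lin : (forall x : 'rV[C]_n, f (im *: x) = im *: f x) ->
  forall (c : C) (x : 'rV[C]_n), f (c *: x) = c *: f x.
Proof. by move=> h c x; rewrite rlZ h scalerA -scalerDl [_%:C * im]mulrC -complexIE. Qed.

Lemma rl_antilin : (forall x : 'rV[C]_n, f (im *: x) = - im *: f x) ->
  forall (c : C) (x : 'rV[C]_n), f (c *: x) = (conjc c) *: f x.
Proof.
move=> h c x; rewrite rlZ h scalerA -scalerDl; congr (_ *: _).
by case: c => a b; apply/eqP; rewrite eq_complex /=; apply/andP; split;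
  apply/eqP; ring.
Qed.

(** The matrices come from the linear and antilinear parts [(f x -+ i f (i x)) / 2]; the antilinear
    one is first composed with conjugation, which makes it linear. *)
Lemma real_linear_mx :
  exists A B : 'M[C]_n, forall x, f x = x *m A + conjmx x *m B.
Proof.
have two : (2 : C) != 0 by rewrite pnatr_eq0.
have [A fA] : exists A : 'M[C]_n, forall x, 2^-1 *: (f x - im *: f (im *: x)) = x *m A.
  apply: linear_matrix => [x y|c x].
    rewrite (rlD x y) [im *: (x + y)]scalerDr (rlD (im *: x)).
    by rewrite -[RHS]scalerDr; congr (_ *: _); rewrite scalerDr opprD addrACA.
  rewrite [im *: (c *: x)]scalerA [im * c]mulrC -scalerA (rlZ c x) (rlZ c (_ *: x)).
  rewrite [im *: (im *: x)]scalerA im2 scaleN1r rlN [c in RHS]complexIE.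
  by apply/rowP => k; rewrite !mxE; ring: im2.
have [B fB] : exists B : 'M[C]_n, forall x,
    2^-1 *: (f (conjmx x) + im *: f (im *: conjmx x)) = x *m B.
  apply: linear_matrix => [x y|c x].
    rewrite conjmxD (rlD (conjmx x)) [im *: (_ + _)]scalerDr (rlD (im *: _)).
    by rewrite -[RHS]scalerDr; congr (_ *: _); rewrite scalerDr addrACA.
  rewrite conjmxZ [im *: (_ *: _)]scalerA [im * _]mulrC -scalerA.
  rewrite (rlZ (conjc c) (conjmx x)) (rlZ (conjc c) (_ *: conjmx x)).
  rewrite [im *: (im *: _)]scalerA im2 scaleN1r rlN [c in RHS]complexIE.
  have -> : complex.Re (conjc c) = complex.Re c by case: c.
  have -> : complex.Im (conjc c) = - complex.Im c by case: c.
  by apply/rowP => k; rewrite !mxE [(- _)%:C]rmorphN; ring: im2.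
exists A, B => x; rewrite -fA -fB conjmxK; apply/rowP => k.
by rewrite !mxE; field.
Qed.

(** A dimension count over the complex numbers: [f] is the restriction to pairs [(x, conj x)] of the
    complex-linear map [M] on pairs [(x, y)], and injectivity passes to [M]. *)
Lemma real_linear_surj : (forall x, f x = 0 -> x = 0) -> forall a, exists x, f x = a.
Proof.
move=> inj a; have [A [B fE]] := real_linear_mx.
have two : (2 : C) != 0 by rewrite pnatr_eq0.
pose M := block_mx A (conjmx B) B (conjmx A).
have uM : M \in unitmx.
  apply: unitmx_row_inj => v; rewrite -[v]hsubmxK; set x := lsubmx v; set y := rsubmx v.
  rewrite mul_row_block -[RHS]row_mx0 => /eq_row_mx[h1 h2].
  have h3 : conjmx y *m A + conjmx x *m B = 0.
    have := congr1 (@conjmx _ _) h2; rewrite conjmxD !conjmxM !conjmxK addrC => ->.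
    by apply/rowP => k; rewrite !mxE conjc0.
  (* The kernel of [M] is stable under the conjugation [(x, y) |-> (conj y, conj x)]; the real and
     imaginary parts of a kernel vector are killed by [f]. *)
  have h4 : x + conjmx y = 0.
    apply: inj; rewrite fE conjmxD conjmxK !mulmxDl [X in _ + X]addrC addrACA.
    by rewrite h1 h3 addr0.
  have h5 : im *: (x - conjmx y) = 0.
    apply: inj; rewrite fE conjmxZ conj_im conjmxD.
    have -> : conjmx (- conjmx y) = - y.
      by apply/rowP => k; rewrite !mxE rmorphN /= conjcK.
    rewrite -!scalemxAl !mulmxDl !mulNmx; apply/rowP => k.
    have := congr1 (fun v : 'rV_n => v 0 k) h1.
    have := congr1 (fun v : 'rV_n => v 0 k) h3.
    move: (x *m A) (y *m B) (_ *m A) (_ *m B) => a1 a2 a3 a4.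
    rewrite !mxE => q3 q1.
    transitivity (im * ((a1 0 k + a2 0 k) - (a3 0 k + a4 0 k))); first by ring.
    by rewrite q1 q3 subrr mulr0.
  have x0 : x = 0.
    have : x - conjmx y = 0.
      by apply: (@scalerI _ _ im); rewrite ?scaler0 // eq_complex /= oner_eq0 andbF.
    move=> q; apply: (@scalerI _ _ 2); rewrite ?scaler0 //.
    by rewrite scaler_nat mulr2n -[RHS](addr0 0) -{1}h4 -q addrACA subrr addr0.
  have y0 : y = 0.
    by rewrite -[y]conjmxK; move: h4; rewrite x0 add0r => ->; apply/rowP=> k;
       rewrite !mxE conjc0.
  by rewrite x0 y0 row_mx0.
pose v := row_mx a (conjmx a) *m invmx M; pose x := lsubmx v; pose y := rsubmx v.
have : row_mx x y *m M = row_mx a (conjmx a) by rewrite hsubmxK mulmxKV.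
rewrite mul_row_block => /eq_row_mx[h1 h2].
have h3 : conjmx y *m A + conjmx x *m B = a.
  by have := congr1 (@conjmx _ _) h2; rewrite conjmxD !conjmxM !conjmxK addrC.
(* Averaging the solution with its conjugate gives one of the form [(x, conj x)]. *)
exists (2^-1 *: (x + conjmx y)); rewrite fE conjmxZ conjmxD conjmxK.
have -> : conjc (2^-1 : C) = 2^-1 by rewrite conjc_inv (conjc_nat R 2).
rewrite -!scalemxAl !mulmxDl -scalerDr [X in _ + X]addrC addrACA h1 h3.
by rewrite -mulr2n -[a *+ 2]scaler_nat scalerA mulVf ?scale1r.
Qed.

End Theory.
End RealLinear.
Arguments im {R}.

(** * Integrable complex structures on the Lie algebra and their eigenspaces *)

Section LieComplexStructures.
Variable R : rcfType.
Local Notation C := R[i].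
Local Notation V := 'rV[C]_3.

Record complex_structure (J : V -> V) : Prop := ComplexStructure {
  cs_linear : real_linear J;
  cs_square : forall x, J (J x) = - x;
  cs_nijenhuis : forall x y, cross x y + J (cross (J x) y) + J (cross x (J y))
    - cross (J x) (J y) = 0
}.

Lemma im_neq0 : im != 0 :> C.
Proof. by rewrite eq_complex /= oner_eq0 andbF. Qed.

Lemma two_neq0 : (2 : C) != 0. Proof. by rewrite pnatr_eq0. Qed.

(** Passing to the opposite structure exchanges the eigenvalues [im] and [- im], so each result on
    one eigenspace also serves for the other. *)
Lemma complex_structureN (J : V -> V) :
  complex_structure J -> complex_structure (fun x => - J x).
Proof.
case=> JL JJ N; split.
- split=> [x y|a x]; first by rewrite (rlD JL) opprD.
  by rewrite (rlZr JL) scalerN.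
- by move=> x; rewrite (rlN JL) opprK JJ.
- move=> x y; rewrite !crossNl !crossNr opprK !(rlN JL) !opprK; exact: N.
Qed.

Section Structure.
Variable J : V -> V.
Hypothesis csJ : complex_structure J.
Implicit Types (x y z u v w : V) (a b c : C).

Let JL : real_linear J := cs_linear csJ.
Let JJ := cs_square csJ.

(* In the complexification of sl(2,C), which is a sum of two copies of sl(2,C),
   [t10 v] and [t01 v] are the first components of the (1,0)- and (0,1)-vectors
   [v -+ i J v]. Up to a factor, [dbar] is the antilinear part of [J]. *)
Definition t10 v := v - im *: J v.
Definition t01 v := v + im *: J v.
Definition dbar v := J (im *: v) - im *: J v.

Lemma im_im v : im *: (im *: v) = - v.
Proof. by rewrite scalerA im2 scaleN1r. Qed.

Lemma real_linear_add (f g : V -> V) : real_linear f -> real_linear g ->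
  real_linear (fun v => f v + g v).
Proof.
move=> lf lg; split=> [x y|a x]; first by rewrite (rlD lf) (rlD lg) addrACA.
by rewrite (rlZr lf) (rlZr lg) scalerDr.
Qed.

Lemma real_linear_scale c (f : V -> V) : real_linear f ->
  real_linear (fun v => c *: f v).
Proof.
move=> lf; split=> [x y|a x]; first by rewrite (rlD lf) scalerDr.
by rewrite (rlZr lf) !scalerA mulrC.
Qed.

Lemma real_linear_comp (f g : V -> V) : real_linear f -> real_linear g ->
  real_linear (fun v => f (g v)).
Proof.
move=> lf lg; split=> [x y|a x]; first by rewrite (rlD lg) (rlD lf).
by rewrite (rlZr lg) (rlZr lf).
Qed.

Lemma real_linear_id : real_linear (fun v => v : V).
Proof. by []. Qed.

Lemma t10_rl : real_linear t10.
Proof.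
have := real_linear_add real_linear_id (real_linear_scale (- im) JL).
by case=> h1 h2; split=> [x y|a x]; rewrite /t10 -?scaleNr.
Qed.

Lemma t01_rl : real_linear t01.
Proof. exact: real_linear_add real_linear_id (real_linear_scale im JL). Qed.

Lemma dbar_rl : real_linear dbar.
Proof.
have := real_linear_add (real_linear_comp JL (real_linear_scale im real_linear_id))
  (real_linear_scale (- im) JL).
by case=> h1 h2; split=> [x y|a x]; rewrite /dbar -?scaleNr.
Qed.

Lemma dbar_im v : dbar (im *: v) = - im *: dbar v.
Proof.
rewrite /dbar im_im (rlN JL); apply/rowP => k; rewrite !mxE; ring: (im2 R).
Qed.

Lemma dbarZ c v : dbar (c *: v) = conjc c *: dbar v.
Proof. exact: (rl_antilin dbar_rl dbar_im). Qed.

Lemma J_dbar v : J (dbar v) = - dbar (J v).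
Proof. by rewrite /dbar (rlB JL) !JJ; apply/rowP => k; rewrite !mxE; ring. Qed.

(** With [dbar_t01], this places the image of [dbar] inside those of [t10] and [t01], whose elements
    normalise the eigenspaces for [im] and [- im] respectively. *)
Lemma dbar_t10 v : dbar v = t10 (v + J (im *: v)).
Proof.
rewrite /dbar /t10 (rlD JL) JJ; apply/rowP => k; rewrite !mxE; ring: (im2 R).
Qed.

Lemma dbar_t01 v : dbar v = t01 (J (im *: v) - v).
Proof.
rewrite /dbar /t01 (rlB JL) JJ; apply/rowP => k; rewrite !mxE; ring: (im2 R).
Qed.

(** Integrability makes the (1,0)-vectors a subalgebra. In the two factors of the complexification,
    the (1,0)-vector of [v] has components [t10 v] and the conjugate of [t01 v]; hence two equations
    with the same vector [- J s]. *)
Lemma t10_bracket v w : let s := cross (J v) w + cross v (J w) in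
  cross (t10 v) (t10 w) = t10 (- J s) /\ cross (t01 v) (t01 w) = t01 (- J s).
Proof.
move=> s; have Js : J s = cross (J v) (J w) - cross v w.
  apply/eqP; rewrite -subr_eq0 opprB addrC -[X in _ == X](cs_nijenhuis csJ v w).
  by rewrite (rlD JL); apply/eqP/rowP => k; rewrite !mxE; ring.
rewrite /t10 /t01 (rlN JL) JJ opprK Js.
rewrite -[- (im *: J v)]scaleNr -[- (im *: J w)]scaleNr /s !crossDl !crossDr.
rewrite !crossZl !crossZr; move: (cross v w) (cross v (J w)) => p q.
by move: (cross (J v) w) (cross (J v) (J w)) => r t;
   split; apply/rowP => k; rewrite !mxE; ring: (im2 R).
Qed.

Lemma eigen_dbar v : J v = im *: v -> dbar v = 0.
Proof.
by move=> e; rewrite /dbar -e JJ e im_im addrN.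
Qed.

Lemma dbar0_t10 v : dbar v = 0 -> J (t10 v) = im *: t10 v.
Proof.
move=> k0; have := J_dbar v; rewrite k0 (rl0 JL) => /esym/eqP.
rewrite oppr_eq0 /dbar JJ scalerN opprK addr_eq0 => /eqP e.
by rewrite /t10 (rlB JL) e scalerBr im_im !opprK addrC.
Qed.

(** For such [x] the Nijenhuis identity at [x] and [v] collapses to [y + J (im *: y) = 0] with
    [y = cross x (t10 v)]. *)
Lemma eigen_bracket x v : J x = im *: x ->
  J (cross x (t10 v)) = im *: cross x (t10 v).
Proof.
move=> e; set y := cross _ _.
have q : y + J (im *: y) = 0.
  rewrite -[RHS](cs_nijenhuis csJ x v) e !crossZl /y /t10 crossDr crossNr crossZr.
  rewrite scalerBr im_im opprK (rlD JL); apply/rowP => k; rewrite !mxE; ring.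
by rewrite -{1}[y]opprK -[- y]addr0 -{1}q addKr (rlN JL) JJ opprK.
Qed.

End Structure.

Lemma t10N (J : V -> V) v : t10 (fun x => - J x) v = t01 J v.
Proof. by rewrite /t10 /t01 scalerN opprK. Qed.


Lemma dbarN (J : V -> V) v : dbar (fun x => - J x) v = - dbar J v.
Proof. by rewrite /dbar scalerN opprB opprK addrC. Qed.

(** [J (im *: x) = J (J x) = - x = im *: (im *: x)], so the eigenspace is a complex subspace
    although [J] is only real-linear. *)
Lemma eigen_scale (J : V -> V) (csJ : complex_structure J) c x :
  J x = im *: x -> J (c *: x) = im *: (c *: x).
Proof.
have JL := cs_linear csJ; move=> e.
have e' : J (im *: x) = im *: (im *: x) by rewrite im_im -e (cs_square csJ).
rewrite (rlZ JL) e' e [c in RHS]complexIE.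
by apply/rowP => k; rewrite !mxE; ring.
Qed.

Lemma conj_eigen_bracket (J : V -> V) x v : complex_structure J ->
  J x = - im *: x -> J (cross x (t01 J v)) = - im *: cross x (t01 J v).
Proof.
move=> csJ e; have h : - J x = im *: x by rewrite e scaleNr opprK.
have := eigen_bracket (complex_structureN csJ) v h; rewrite t10N => h'.
by rewrite scaleNr -h' opprK.
Qed.

Lemma t10_eq0 (J : V -> V) v : complex_structure J ->
  t10 J v = 0 -> J v = - im *: v.
Proof.
move=> csJ /eqP; rewrite subr_eq0 => /eqP e; rewrite {2}e scaleNr im_im.
by rewrite opprK.
Qed.

(** The kernel of [t10 J] is the eigenspace for [- im], so here [t10 J] is onto; the eigenspace for
    [im], normalised by its image, is then a nonzero ideal. *)
Lemma simple_case (J : V -> V) x : complex_structure J ->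
  (forall v, J v = - im *: v -> v = 0) -> x != 0 -> J x = im *: x ->
  forall v, J v = im *: v.
Proof.
move=> csJ n2 x0 Jx; have JL := cs_linear csJ.
apply: (ideal_full _ _ x0 Jx).
- by move=> a b ea eb; rewrite (rlD JL) ea eb scalerDr.
- by move=> c a; exact: eigen_scale.
move=> a w ea; have [v <-] : exists v, t10 J v = w.
  apply: (real_linear_surj (t10_rl csJ)) => v /(t10_eq0 csJ); exact: n2.
exact: eigen_bracket.
Qed.

(** On the kernel of [dbar J], half of [t10 J] and half of [t01 J] are the projections onto the two
    eigenspaces. *)
Lemma dbar_eigen_sum (J : V -> V) v : complex_structure J ->
  dbar J v = 0 -> exists a b, [/\ J a = im *: a, J b = - im *: b & v = a + b].
Proof.
move=> csJ e; exists (2^-1 *: t10 J v), (2^-1 *: t01 J v); split.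
- by apply: (eigen_scale csJ); exact: dbar0_t10.
- have csN := complex_structureN csJ.
  have e' : dbar (fun x => - J x) v = 0 by rewrite dbarN e oppr0.
  have := eigen_scale csN 2^-1 (dbar0_t10 csN e'); rewrite t10N => h.
  by rewrite scaleNr -h opprK.
- by apply/rowP => k; rewrite !mxE; field.
Qed.

Lemma dbar_eq0_inj (J : V -> V) v : complex_structure J ->
  (forall v, J v = im *: v -> v = 0) -> (forall v, J v = - im *: v -> v = 0) ->
  dbar J v = 0 -> v = 0.
Proof.
by move=> csJ n1 n2 /(dbar_eigen_sum csJ)[a [b [/n1-> /n2-> ->]]]; rewrite addr0.
Qed.

Lemma t01_eq0 (J : V -> V) v : complex_structure J ->
  t01 J v = 0 -> J v = im *: v.
Proof.
move=> csJ; rewrite -t10N => /(t10_eq0 (complex_structureN csJ)).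
by rewrite scaleNr => /oppr_inj.
Qed.

Lemma conjmx_eq0 n (v : 'rV[C]_n) : conjmx v = 0 -> v = 0.
Proof.
move=> e; rewrite -[v]conjmxK e; apply/rowP => k; rewrite !mxE; exact: conjc0.
Qed.

(* If neither i nor -i is an eigenvalue of J, the algebra of (1,0)-vectors is
   the graph of an antilinear automorphism tau of sl(2,C). The linear
   automorphism tau^2 has a fixed vector, hence so has tau; but a vector fixed
   by tau is both of type (1,0) and of type (0,1). *)
Lemma eigenvector_exists (J : V -> V) : complex_structure J ->
  (forall v, J v = im *: v -> v = 0) -> (forall v, J v = - im *: v -> v = 0) ->
  False.
Proof.
move=> csJ n1 n2; have JL := cs_linear csJ; have JJ := cs_square csJ.
have dinj v := dbar_eq0_inj csJ n1 n2 (v := v).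
have tinj v : t10 J v = 0 -> v = 0 by move/(t10_eq0 csJ)/n2.
have tsurj := real_linear_surj (t10_rl csJ) tinj.
have dsurj := real_linear_surj (dbar_rl csJ) dinj.
have [Q dQ] : exists Q, forall z : V, dbar J (conjmx z) = z *m Q.
  apply: linear_matrix => [x y|c x].
    by rewrite conjmxD (rlD (dbar_rl csJ)).
  by rewrite conjmxZ (dbarZ csJ) conjcK.
have uQ : Q \in unitmx.
  by apply: unitmx_row_inj => z; rewrite -dQ => /dinj/conjmx_eq0.
pose e v := v + J (im *: v).
have eL : real_linear e.
  apply: (real_linear_add real_linear_id).
  exact: (real_linear_comp JL (real_linear_scale im real_linear_id)).
have tL := real_linear_comp (t01_rl csJ) eL.
have [S sS] : exists S, forall z : V, t01 J (e z) = z *m S.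
  apply: linear_matrix; first by move=> x y; rewrite (rlD tL).
  apply: (rl_lin tL) => v; rewrite /e /t01 !(rlD JL) !JJ im_im (rlN JL).
  by apply/rowP => k; rewrite !mxE; ring: (im2 R).
(* The automorphism tau is [x |-> conjmx x *m M]; it sends [t10 J v] to [t01 J v]. *)
pose M := invmx (conjmx Q) *m S.
have uQ' : conjmx Q \in unitmx by rewrite map_unitmx.
have MT v : conjmx (t10 J v) *m M = t01 J v.
  have [w ew] := dsurj (t10 J v).
  have -> : v = e w.
    (* By [dbar_t10], [dbar J w = t10 J (e w)], and [t10 J] is injective. *)
    by apply/eqP; rewrite -subr_eq0; apply/eqP/tinj;
      rewrite (rlB (t10_rl csJ)) -ew dbar_t10 // subrr.
  rewrite -(dbar_t10 csJ) sS -[in LHS](conjmxK w) dQ conjmxM conjmxK /M.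
  by rewrite -mulmxA mulKVmx.
have MB a b : conjmx (cross a b) *m M = cross (conjmx a *m M) (conjmx b *m M).
  have [v <-] := tsurj a; have [w <-] := tsurj b.
  have [-> h] := t10_bracket csJ v w.
  exact: etrans (MT _) (etrans (esym h) (congr2 _ (esym (MT v)) (esym (MT w)))).
have uM : M \in unitmx.
  apply: unitmx_row_inj => v; rewrite -[v]conjmxK.
  have [w <-] := tsurj (conjmx v).
  by rewrite MT => /(t01_eq0 csJ)/n1 ->; rewrite (rl0 (t10_rl csJ)) /conjmx map_mx0.
pose N := conjmx M *m M.
have NE a : a *m N = conjmx (conjmx a *m M) *m M.
  by rewrite conjmxM conjmxK mulmxA.
have [a a0 Na] : exists2 a : V, a != 0 & a *m N = a.
  apply: cross_automorphism_fixed; first by rewrite unitmx_mul map_unitmx uM.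
  by move=> a b; rewrite !NE -!MB.
(* A vector [a] fixed by tau^2 yields the tau-fixed vector [a + tau a], or [im *: a] when that sum
   vanishes, as tau is antilinear. *)
have [b b0 tb] : exists2 b : V, b != 0 & conjmx b *m M = b.
  have [z|nz] := eqVneq (a + conjmx a *m M) 0; last first.
    by exists (a + conjmx a *m M) => //; rewrite conjmxD mulmxDl -NE Na addrC.
  exists (im *: a); first by rewrite scaler_eq0 (negPf im_neq0).
  move/eqP: z; rewrite addr_eq0 => /eqP z.
  by rewrite conjmxZ conj_im -scalemxAl scaleNr [in RHS]z scalerN.
have [v vb] := tsurj b; case/eqP: b0; rewrite -vb.
have : t01 J v = t10 J v by rewrite -MT vb tb.
move=> h; have Jv : J v = 0.
  have : (2 * im) *: J v = 0.
    rewrite -[RHS](subrr (t10 J v)) -{1}h.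
    by apply/rowP => k; rewrite !mxE; ring.
  move/eqP; rewrite scaler_eq0 mulf_eq0 (negPf two_neq0) (negPf im_neq0).
  by move=> /eqP.
by rewrite -[v]opprK -(JJ v) Jv (rl0 JL) oppr0 (rl0 (t10_rl csJ)).
Qed.

End LieComplexStructures.

(** * Three independent complex lines preserved by the complex structure *)

Section InvariantLines.
Variable R : rcfType.
Local Notation C := R[i].
Local Notation V := 'rV[C]_3.
Implicit Types (J : V -> V) (x y z u v w : V) (a b c : C).

(** A real-linear self-map of the complex line of [x] is the sum of a linear and an antilinear part,
    with coefficients [p] and [q]. *)
Definition stable_line J x :=
  exists p q, forall c, J (c *: x) = (p * c + q * conjc c) *: x.

Lemma stable_line_intro J x a b : complex_structure J ->
  J x = a *: x -> J (im *: x) = b *: x -> stable_line J x.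
Proof.
(* The values at [c = 1] and [c = im] impose [p + q = a] and [im * (p - q) = b]. *)
move=> csJ ea eb; exists (2^-1 * (a - im * b)), (2^-1 * (a + im * b)) => c.
rewrite (rlZ (cs_linear csJ)) ea eb !scalerA -scalerDl; congr (_ *: _).
have cc : conjc c = (complex.Re c)%:C - im * (complex.Im c)%:C.
  by case: c => r s; apply/eqP; rewrite eq_complex /=; apply/andP; split;
    apply/eqP; ring.
have two := two_neq0 R; apply: (mulfI two).
rewrite {}cc; move: (complexIE c); move: (complex.Re c) (complex.Im c) => r s ->.
by field: (im2 R).
Qed.

Lemma stable_line_eigen J x : complex_structure J -> J x = im *: x -> stable_line J x.
Proof.
move=> csJ e; apply: (stable_line_intro csJ e (b := -1)).
by rewrite -e (cs_square csJ) scaleN1r.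
Qed.

Lemma stable_line_conj_eigen J x :
  complex_structure J -> J x = - im *: x -> stable_line J x.
Proof.
move=> csJ e; apply: (stable_line_intro csJ e (b := 1)).
have e' : im *: x = - J x by rewrite e scaleNr opprK.
by rewrite e' (rlN (cs_linear csJ)) (cs_square csJ) opprK scale1r.
Qed.

(** Up to the factor [im], applying [J] to the relation only changes the sign of its second term. *)
Lemma eigen_independent J x y a b : complex_structure J ->
  x != 0 -> y != 0 -> J x = im *: x -> J y = - im *: y ->
  a *: x + b *: y = 0 -> a = 0 /\ b = 0.
Proof.
move=> csJ x0 y0 ex ey e; have JL := cs_linear csJ.
have e' : a *: x - b *: y = 0.
  apply: (@scalerI _ _ im); first exact: im_neq0.
  have h : J (a *: x + b *: y) = im *: (a *: x - b *: y).
    rewrite (rlD JL) (eigen_scale csJ a ex) scalerBr; congr (_ + _).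
    have ey' : - J y = im *: y by rewrite ey scaleNr opprK.
    by have := eigen_scale (complex_structureN csJ) b ey' => <-; rewrite opprK.
  by rewrite -h e (rl0 JL) scaler0.
have ax : a *: x = 0.
  apply: (@scalerI _ _ 2); first exact: two_neq0.
  by rewrite scaler0 scaler_nat mulr2n -[RHS]addr0 -{1}e -e' addrACA subrr addr0.
split; first by move/eqP: ax; rewrite scaler_eq0 (negPf x0) orbF => /eqP.
by move/eqP: e; rewrite ax add0r scaler_eq0 (negPf y0) orbF => /eqP.
Qed.

(* [u] is not isotropic, so its normaliser is the line it spans; as [im t10]
   normalises that line, this forces [dbar = 0]. *)
Lemma dbar_not_eigen J u y v0 : complex_structure J ->
  u != 0 -> y != 0 -> J u = im *: u -> J y = - im *: y -> dbar J v0 = u ->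
  (forall z, J z = im *: z -> exists c, z = c *: u) ->
  (forall z, J z = - im *: z -> exists c, z = c *: y) -> False.
Proof.
move=> csJ u0 y0 eu ey ku n1 n2; have JL := cs_linear csJ; have JJ := cs_square csJ.
(* As a value of [t01 J], the vector [u] normalises the eigenspace for [- im], which is the line of
   [y]. *)
have [l uy] : exists l, cross u y = l *: y.
  have := conj_eigen_bracket (J (im *: v0) - v0) csJ ey.
  rewrite -dbar_t01 // ku => /n2[c e]; exists (- c).
  by rewrite crossC e scaleNr.
have l0 : l != 0.
  apply/eqP => l0; move: uy; rewrite l0 scale0r => /(cross_eq0 u0)[c yc].
  have : (- c) *: u + 1 *: y = 0 by rewrite yc scaleNr scale1r addNr.
  by case/(eigen_independent csJ u0 y0 eu ey) => _ /eqP; rewrite oner_eq0.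
(* [u] is orthogonal to [cross u y = l *: y], hence to [y], and [cross_cross] then gives
   [l^2 *: y = - dot u u *: y]. *)
have uu : dot u u != 0.
  have : dot u (cross u y) = 0 := dot_cross u y.
  rewrite uy dotZr => /eqP; rewrite mulf_eq0 (negPf l0) /= => /eqP duy.
  have := cross_cross u y; rewrite duy uy crossZr uy scale0r sub0r => e.
  apply: contraNneq l0 => d0; move/eqP: e; rewrite d0 scale0r oppr0 scalerA.
  by rewrite scaler_eq0 (negPf y0) orbF mulf_eq0 orbb.
(* [cross u (t10 J v)] is a multiple of [u] orthogonal to [u], hence zero. *)
have tu v : exists c, t10 J v = c *: u.
  apply: cross_eq0 => //.
  have [c e] := n1 _ (eigen_bracket csJ v eu).
  have := dot_cross u (t10 J v); rewrite e dotZr => /eqP.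
  by rewrite mulf_eq0 (negPf uu) orbF => /eqP ->; rewrite scale0r.
case/eqP: u0; rewrite -ku.
suff k0 w : dbar J (J w) = 0 by rewrite -[v0]opprK -(JJ v0) (rlN (dbar_rl csJ)) k0 oppr0.
have [c e] := tu w; have := eigen_scale csJ c eu; rewrite -e.
rewrite /t10 /dbar (rlB JL) scalerBr im_im !opprK addrC => /addIr/eqP.
by rewrite eqr_oppLR => /eqP ->; rewrite JJ scalerN subrr.
Qed.

Lemma stable_rows J x y z : stable_line J x -> stable_line J y -> stable_line J z ->
  forall k, stable_line J (row k (mat3 x y z)).
Proof. by move=> ? ? ?; apply: ord3P; rewrite rowK. Qed.

(** [J] is then complex linear with square -1, hence diagonalisable: the rows of [1 - im P] and
    [1 + im P] are eigenvectors and span, the two matrices adding up to 2, so a basis can be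
    extracted. *)
Lemma stable_basis_linear J : complex_structure J -> (forall v, dbar J v = 0) ->
  exists2 B : 'M[C]_3, B \in unitmx & forall k, stable_line J (row k B).
Proof.
move=> csJ k0; have JL := cs_linear csJ.
have JI v : J (im *: v) = im *: J v by apply/eqP; rewrite -subr_eq0 -/(dbar J v) k0.
have [P JP] := linear_matrix (rlD JL) (rl_lin JL JI).
pose S := col_mx (1%:M - im *: P) (1%:M + im *: P).
have fS : row_full S.
  apply/row_fullP; exists (row_mx (2^-1)%:M (2^-1)%:M).
  rewrite mul_row_col !mul_scalar_mx -scalerDr addrACA addNr addr0 -mulr2n.
  by rewrite -[1%:M *+ 2]scaler_nat scalerA mulVf ?scale1r // two_neq0.
exists (rowsub (fullrankfun fS) S); first exact: fullrowsub_unit.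
move=> k; rewrite row_rowsub; case: (split_ordP (fullrankfun fS k)) => j ->.
- rewrite rowKu; apply: stable_line_eigen => //.
  rewrite rowE mulmxBr mulmx1 -scalemxAr -JP -/(t10 J _).
  exact: dbar0_t10.
- rewrite rowKd; apply: stable_line_conj_eigen => //.
  rewrite rowE mulmxDr mulmx1 -scalemxAr -JP -/(t01 J _).
  have csN := complex_structureN csJ; set v := delta_mx _ _.
  have e' : dbar (fun x => - J x) v = 0 by rewrite dbarN k0 oppr0.
  by have := dbar0_t10 csN e'; rewrite t10N => h; rewrite scaleNr -h opprK.
Qed.

Lemma eigen_disjoint v w : w = im *: v -> w = - im *: v -> v = 0.
Proof.
move=> -> /eqP; rewrite -subr_eq0 scaleNr opprK -mulr2n -scaler_nat.
by rewrite !scaler_eq0 (negPf (two_neq0 R)) (negPf (im_neq0 R)) => /eqP.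
Qed.

Lemma conj_eigen_scale J c x : complex_structure J ->
  J x = - im *: x -> J (c *: x) = - im *: (c *: x).
Proof.
move=> csJ e; have e' : - J x = im *: x by rewrite e scaleNr opprK.
have := eigen_scale (complex_structureN csJ) c e' => h.
by rewrite scaleNr -h opprK.
Qed.

Lemma stable_basis J : complex_structure J ->
  exists2 B : 'M[C]_3, B \in unitmx & forall k, stable_line J (row k B).
Proof.
move=> csJ; have JL := cs_linear csJ; have JJ := cs_square csJ.
have csN := complex_structureN csJ.
have oppE v : - J v = im *: v <-> J v = - im *: v.
  by rewrite scaleNr; split=> [<-|->]; rewrite opprK.
have oppE' v : - J v = - im *: v <-> J v = im *: v.
  by rewrite scaleNr; split=> [/oppr_inj|->].
have [k0|/existsNP[v0 /eqP u0]] := pselect (forall v, dbar J v = 0).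
  exact: stable_basis_linear.
(* Without eigenvectors for [im], either one for [- im] forces [J = - im] by simplicity, against
   [dbar J v0 != 0], or there is no eigenvector at all, which is impossible. *)
have [[x [x0 ex]]|n1] := pselect (exists x, x != 0 /\ J x = im *: x); last first.
  have {}n1 v : J v = im *: v -> v = 0.
    by move=> e; apply/eqP/negPn/negP => v1; apply: n1; exists v.
  have [[y [y0 ey]]|n2] := pselect (exists x, x != 0 /\ J x = - im *: x).
    have := simple_case csN _ y0 ((oppE _).2 ey).
    have h v : - J v = - im *: v -> v = 0 by move/oppE'/n1.
    move=> /(_ h v0)/(eigen_dbar csN)/eqP.
    by rewrite dbarN oppr_eq0 (negPf u0).
  case: (eigenvector_exists csJ n1) => v e.
  by apply/eqP/negPn/negP => v1; apply: n2; exists v.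
have [[y [y0 ey]]|n2] := pselect (exists x, x != 0 /\ J x = - im *: x); last first.
  have {}n2 v : J v = - im *: v -> v = 0.
    by move=> e; apply/eqP/negPn/negP => v1; apply: n2; exists v.
  by have /eqP := eigen_dbar csJ (simple_case csJ n2 x0 ex v0); rewrite (negPf u0).
have kx : dbar J x = 0 by apply: eigen_dbar.
have ky : dbar J y = 0.
  by apply/eqP; rewrite -oppr_eq0 -dbarN; apply/eqP/(eigen_dbar csN)/oppE.
have kD a b c z : dbar J (a *: x + b *: y + c *: z) = conjc c *: dbar J z.
  rewrite !(rlD (dbar_rl csJ)) !(dbarZ csJ) kx ky !scaler0 !add0r //.
have indep z : dbar J z != 0 -> mat3 x y z \in unitmx.
  move=> z0; apply: mat3_unit => a b c e.
  have := kD a b c z; rewrite e (rl0 (dbar_rl csJ)) => /esym/eqP.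
  rewrite scaler_eq0 (negPf z0) orbF conjc_eq0 => /eqP c0.
  move: e; rewrite c0 scale0r addr0 => /(eigen_independent csJ x0 y0 ex ey)[-> ->].
  by [].
set u := dbar J v0 in u0.
have span := mat3_span _ (indep _ u0).
(* [dbar J] kills [x] and [y], so its image is the line of [u]; this line is [J]-stable because [J]
   anticommutes with [dbar J]. *)
have imK w : exists c, dbar J w = c *: u.
  by have [a [b [c ->]]] := span w; exists (conjc c); rewrite kD.
have Ju : exists a, J u = a *: u.
  have [c e] := imK (J v0); exists (- c).
  by rewrite /u J_dbar // e scaleNr.
have Jiu : exists b, J (im *: u) = b *: u.
  have [c e] := imK (J (- im *: v0)); exists (- c).
  have -> : im *: u = dbar J (- im *: v0).
    by rewrite scaleNr (rlN (dbar_rl csJ)) dbar_im // scaleNr opprK.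
  by rewrite J_dbar // e scaleNr.
have [ku|ku] := eqVneq (dbar J u) 0; last first.
  exists (mat3 x y u); first exact: indep.
  apply: stable_rows; first exact: stable_line_eigen.
    exact: stable_line_conj_eigen.
  by case: Ju => a ea; case: Jiu => b eb; exact: stable_line_intro csJ ea eb.
(* In the remaining case [u] lies in the sum of the two eigenspaces, which are exactly the lines of
   [x] and [y]. *)
exfalso.
have xy z : dbar J z = 0 -> exists a b, z = a *: x + b *: y.
  move=> kz; have [a [b [c e]]] := span z; exists a, b.
  have := kD a b c v0; rewrite -e kz => /esym/eqP.
  rewrite scaler_eq0 (negPf u0) orbF conjc_eq0 => /eqP c0.
  by rewrite e c0 scale0r addr0.
have ns1 z : J z = im *: z -> exists c, z = c *: x.
  move=> ez; have [a [b e]] := xy z (eigen_dbar csJ ez); exists a.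
  suff by0 : b *: y = 0 by rewrite e by0 addr0.
  apply: eigen_disjoint (conj_eigen_scale b csJ ey).
  have -> : b *: y = z - a *: x by rewrite e addrC addKr.
  by rewrite (rlB JL) ez (eigen_scale csJ a ex) scalerBr.
have ns2 z : J z = - im *: z -> exists c, z = c *: y.
  move=> ez; have kz : dbar J z = 0.
    by apply/eqP; rewrite -oppr_eq0 -dbarN; apply/eqP/(eigen_dbar csN)/oppE.
  have [a [b e]] := xy z kz; exists b.
  suff ax0 : a *: x = 0 by rewrite e ax0 add0r.
  apply: eigen_disjoint (eigen_scale csJ a ex) _.
  have -> : a *: x = z - b *: y by rewrite e addrK.
  by rewrite (rlB JL) ez (conj_eigen_scale b csJ ey) scalerBr.
have line z w a : z = a *: w -> z != 0 ->
    forall v, (exists c, v = c *: w) -> exists c, v = c *: z.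
  move=> zw z0 v [c vc]; exists (c / a); rewrite zw scalerA mulfVK //.
  by apply: contraNneq z0 => a0; rewrite zw a0 scale0r.
have [a [b uab]] := xy u ku; have Jiu' : J (im *: u) = im *: J u.
  by apply/eqP; rewrite -subr_eq0 -/(dbar J u) ku.
have Juab : J u = im *: (a *: x) - im *: (b *: y).
  by rewrite uab (rlD JL) (eigen_scale csJ a ex) (conj_eigen_scale b csJ ey) scaleNr.
have [m Jum] := Ju.
have [a0|a1] := eqVneq a 0.
  have uy : u = b *: y by rewrite uab a0 scale0r add0r.
  have eu : J u = - im *: u by rewrite {1}uy (conj_eigen_scale b csJ ey) -uy.
  (* For the opposite structure the two eigenspaces are exchanged, and [- v0] compensates the sign
     of [dbar]. *)
  apply: (dbar_not_eigen csN u0 x0 ((oppE _).2 eu) ((oppE' _).2 ex) (v0 := - v0)).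
  - by rewrite dbarN (rlN (dbar_rl csJ)) opprK.
  - by move=> z /oppE/ns2; exact: line uy u0 z.
  - by move=> z /oppE'/ns1.
have [b0|b1] := eqVneq b 0.
  have ux : u = a *: x by rewrite uab b0 scale0r addr0.
  have eu : J u = im *: u by rewrite {1}ux (eigen_scale csJ a ex) -ux.
  apply: (dbar_not_eigen csJ u0 y0 eu ey (erefl _)) => z.
  - by move=> /ns1; exact: line ux u0 z.
  - exact: ns2.
(* With both components of [u] nonzero, the factor [m] in [J u = m *: u] would be both [im] and
   [- im]. *)
have : ((m - im) * a) *: x + ((m + im) * b) *: y = 0.
  transitivity (m *: u - J u); last by rewrite Jum subrr.
  by rewrite Juab uab; apply/rowP => k; rewrite !mxE; ring.
case/(eigen_independent csJ x0 y0 ex ey) => /eqP; rewrite mulf_eq0 (negPf a1) orbF.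
rewrite subr_eq0 => /eqP -> /eqP; rewrite mulf_eq0 (negPf b1) orbF -mulr2n.
by rewrite -mulr_natl mulf_eq0 (negPf (two_neq0 R)) (negPf (im_neq0 R)).
Qed.

End InvariantLines.

(** * Splitting into complex lines, and the area forms on them *)

Section NormalForm.
Variable R : rcfType.
Local Notation C := R[i].
Local Notation V := 'rV[C]_3.

Definition line_map (p q a : C) : C := p * a + q * conjc a.

(** [G] is the inverse of the matrix of a basis of stable lines, so [x *m G] lists the coordinates
    of [x] along these lines. *)
Theorem normal_form (J : V -> V) : complex_structure J ->
  exists (G : 'M[C]_3) (p q : 'I_3 -> C), [/\ G \in unitmx,
    forall x k, (J x *m G) 0 k = line_map (p k) (q k) ((x *m G) 0 k) &
    forall k a, line_map (p k) (q k) (line_map (p k) (q k) a) = - a].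
Proof.
move=> csJ; have [B uB sB] := stable_basis csJ; have JL := cs_linear csJ.
have /choice[pq pqE] k : exists pq : C * C, forall c,
    J (c *: row k B) = line_map pq.1 pq.2 c *: row k B.
  by have [p [q h]] := sB k; exists (p, q).
have JB v : J (v *m B) = (\row_k line_map (pq k).1 (pq k).2 (v 0 k)) *m B.
  by rewrite !mulmx_sum_row !sum3 !(rlD JL) !pqE !mxE.
have JG x k : (J x *m invmx B) 0 k =
    line_map (pq k).1 (pq k).2 ((x *m invmx B) 0 k).
  by rewrite -{1}[x](mulmxKV uB) JB mulmxK // !mxE.
exists (invmx B), (fst \o pq), (snd \o pq); split=> //; first by rewrite unitmx_inv.
move=> k a; pose x : V := (a *: delta_mx 0 k) *m B.
have xG : (x *m invmx B) 0 k = a by rewrite mulmxK // !mxE !eqxx mulr1.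
by rewrite /= -xG -!JG (cs_square csJ) mulNmx mxE.
Qed.

(** The form [(i/2) z /\ conj z] on a complex line. *)
Definition area (a b : C) : R := complex.Im (conjc a * b).

Definition orientation (p : C) : R := if 0 < complex.Im p then 1 else -1.

Section Line.
Variables p q : C.
Local Notation j := (line_map p q).
Hypothesis jj : forall a, j (j a) = - a.

(** [j (j a) = (p^2 + |q|^2) a + 2 (Re p) q conj a], so [q = 0] unless [Re p = 0], and in that case
    [p^2 = -1] again gives [Re p = 0]. *)
Lemma line_map_coef : complex.Re p = 0 /\
  complex.Im p ^+ 2 = 1 + complex.Re q ^+ 2 + complex.Im q ^+ 2.
Proof.
move: (jj 1) (jj im); rewrite /line_map /im; case: p q => [p1 p2] [q1 q2] /=.
move=> /eqP; rewrite eq_complex /= => /andP[/eqP h1 /eqP h2].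
move=> /eqP; rewrite eq_complex /= => /andP[/eqP h3 /eqP h4].
have k1 : p1 * q1 = 0 by lra.
have k2 : p1 * q2 = 0 by lra.
have k3 : p1 * p2 = 0 by lra.
have k4 : p1 ^+ 2 - p2 ^+ 2 + q1 ^+ 2 + q2 ^+ 2 = -1 by lra.
have p10 : p1 = 0.
  apply/eqP; rewrite -[_ == _]negbK; apply/negP => nz.
  move: k1 k2 k3 => /eqP + /eqP + /eqP.
  rewrite !mulf_eq0 (negPf nz) /= => /eqP q10 /eqP q20 /eqP p20.
  by move: k4 (sqr_ge0 p1); rewrite q10 q20 p20 expr0n /=; lra.
by split=> //; move: k4; rewrite p10 expr0n /=; lra.
Qed.

(** The real determinant of [j] is [|p|^2 - |q|^2], which is 1 by [line_map_coef]. *)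
Lemma area_line_map a b : area (j a) (j b) = area a b.
Proof.
have [p1 p2] := line_map_coef; move: p1 p2; rewrite /area /line_map.
case: p q a b => [p1 p2] [q1 q2] [a1 a2] [b1 b2] /= -> h.
by ring: h.
Qed.

Lemma areaC a b : area b a = - area a b.
Proof. by rewrite /area; case: a b => [a1 a2] [b1 b2] /=; ring. Qed.

Lemma area_line_map_sym a b : area a (j b) = area b (j a).
Proof. by rewrite -area_line_map jj areaC /area; case: (j a) b => [? ?] [? ?] /=; ring. Qed.

Lemma area_gt0 a : a != 0 -> 0 < orientation p * area a (j a).
Proof.
have [p1 p2] := line_map_coef; move: p1 p2; rewrite /area /line_map /orientation.
case: p q a => [p1 p2] [q1 q2] [x y] /= -> h; rewrite eq_complex /= => nz.
have r0 : 0 < x ^+ 2 + y ^+ 2.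
  move: nz; rewrite negb_and => /orP[] z.
    have := sqr_ge0 y; have : 0 < x ^+ 2 by rewrite exprn_even_gt0.
    lra.
  have := sqr_ge0 x; have : 0 < y ^+ 2 by rewrite exprn_even_gt0.
  lra.
(* The quadratic form with matrix [[s + e, f; f, s - e]] has determinant 1; multiplying by [s + e]
   completes the square. [area a (j a)] is this form for [s = Im p], [e = Im q], [f = - Re q]. *)
have pos s e f : s ^+ 2 = 1 + e ^+ 2 + f ^+ 2 -> 0 < s ->
    0 < s * (x ^+ 2 + y ^+ 2) + e * (x ^+ 2 - y ^+ 2) + 2 * f * (x * y).
  move=> hs s0; have se : 0 < s + e.
    by rewrite ltNge; apply/negP => le; have := sqr_ge0 f; nra.
  rewrite -(pmulr_rgt0 _ se).
  rewrite [X in 0 < X](_ : _ = ((s + e) * x + f * y) ^+ 2 + y ^+ 2); last by ring: hs.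
  have [y0|y1] := eqVneq y 0.
    move: r0; rewrite y0 expr0n mulr0 !addr0 => x2.
    by rewrite exprMn mulr_gt0 // exprn_gt0.
  by apply: ltr_wpDl; rewrite ?sqr_ge0 // exprn_even_gt0.
have p2n0 : p2 != 0.
  apply: contra_eq_neq h => ->; rewrite expr0n /= lt_eqF //.
  by have := sqr_ge0 q1; have := sqr_ge0 q2; lra.
case: (ltrP 0 p2) => p2s.
  rewrite mul1r; have := pos p2 q2 (- q1) _ p2s.
  rewrite sqrrN h addrAC => /(_ erefl); congr (0 < _); ring.
have p2s' : 0 < - p2 by rewrite oppr_gt0 lt_neqAle p2n0.
have := pos (- p2) (- q2) q1 _ p2s'.
by rewrite !sqrrN h addrAC => /(_ erefl); congr (0 < _); ring.
Qed.

End Line.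

(** The values of [(i/2 z /\ conj z) /\ (i/2 w /\ conj w) = (1/4) (z /\ w) /\ conj (z /\ w)]. The
    right side lists half of the six shuffles; the others are their conjugates. *)
Lemma pfaffian_area (I : Type) (a b : I -> C) (i j k l : I) :
  2 * (area (a i) (a j) * area (b k) (b l) - area (a i) (a k) * area (b j) (b l)
  + area (a i) (a l) * area (b j) (b k)
  + (area (b i) (b j) * area (a k) (a l) - area (b i) (b k) * area (a j) (a l)
  + area (b i) (b l) * area (a j) (a k))) =
  complex.Re ((a i * b j - a j * b i) * conjc (a k * b l - a l * b k)
    - (a i * b k - a k * b i) * conjc (a j * b l - a l * b j)
    + (a i * b l - a l * b i) * conjc (a j * b k - a k * b j)).
Proof.
rewrite /area; move: (a i) (a j) (a k) (a l) (b i) (b j) (b k) (b l).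
by move=> [? ?] [? ?] [? ?] [? ?] [? ?] [? ?] [? ?] [? ?] /=; ring.
Qed.

(** A 2-form pulled back from a real plane has square zero. *)
Lemma pfaffian_area_self (I : Type) (a : I -> C) (i j k l : I) :
  area (a i) (a j) * area (a k) (a l) - area (a i) (a k) * area (a j) (a l)
  + area (a i) (a l) * area (a j) (a k) = 0.
Proof.
rewrite /area; move: (a i) (a j) (a k) (a l).
by move=> [? ?] [? ?] [? ?] [? ?] /=; ring.
Qed.

(* Squaring a sum of area forms only leaves mixed terms, and the wedge of two
   area forms is that of a complex 2-form with its conjugate. *)
Lemma pfaffian_sum (I : Type) (z : I -> V) (s : 'I_3 -> R) (i j k l : I) :
  let w m n := \sum_(h < 3) s h * area (z m 0 h) (z n 0 h) in
  let Phi f g m n := z m 0 f * z n 0 g - z n 0 f * z m 0 g in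
  let quad f g := complex.Re (Phi f g i j * conjc (Phi f g k l)
    - Phi f g i k * conjc (Phi f g j l) + Phi f g i l * conjc (Phi f g j k)) in
  2 * (w i j * w k l - w i k * w j l + w i l * w j k) =
  s e0 * s e1 * quad e0 e1 + s e0 * s e2 * quad e0 e2 + s e1 * s e2 * quad e1 e2.
Proof.
move=> w Phi quad; rewrite /quad /Phi /w !sum3.
rewrite -!(pfaffian_area (fun m => z m 0 _) (fun m => z m 0 _)).
have self f : area (z i 0 f) (z j 0 f) * area (z k 0 f) (z l 0 f) =
    area (z i 0 f) (z k 0 f) * area (z j 0 f) (z l 0 f)
    - area (z i 0 f) (z l 0 f) * area (z j 0 f) (z k 0 f).
  apply/subr0_eq; rewrite -[RHS](pfaffian_area_self (fun m => z m 0 f) i j k l).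
  by ring.
by ring: (self e0) (self e1) (self e2).
Qed.

End NormalForm.

(** * Pauli coordinates on sl(2,C), and the bracket as a form on M_2(C) *)

Section SL2.
Variable R : rcfType.
Local Notation C := R[i].
Local Notation M := 'M[C]_2.
Implicit Types (m n : M) (x y : 'rV[C]_3).

Definition o0 : 'I_2 := @Ordinal 2 0 isT.
Definition o1 : 'I_2 := @Ordinal 2 1 isT.

Lemma ord2P (P : 'I_2 -> Prop) : P o0 -> P o1 -> forall k, P k.
Proof.
move=> P0 P1 [[|[|k]] hk] //.
- by rewrite (_ : Ordinal hk = o0) //; apply: val_inj.
- by rewrite (_ : Ordinal hk = o1) //; apply: val_inj.
Qed.

Lemma sum2 (W : nmodType) (f : 'I_2 -> W) : \sum_(k < 2) f k = f o0 + f o1.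
Proof.
rewrite !big_ord_recr big_ord0 /= add0r.
by congr (f _ + f _); apply: val_inj.
Qed.

Lemma mx2P m n : m o0 o0 = n o0 o0 -> m o0 o1 = n o0 o1 ->
  m o1 o0 = n o1 o0 -> m o1 o1 = n o1 o1 -> m = n.
Proof. by move=> *; apply/matrixP; apply: ord2P; apply: ord2P. Qed.

Definition mx2 (a b c d : C) : M :=
  \matrix_(i, j) nth 0 (nth [::] [:: [:: a; b]; [:: c; d]] i) j.

(* The basis of sl(2,C) given by the Pauli matrices divided by 2i, in which the
   bracket is the cross product. *)
Definition pauli x : M :=
  2^-1 *: mx2 (- im * x 0 e2) (- im * x 0 e0 - x 0 e1)
              (- im * x 0 e0 + x 0 e1) (im * x 0 e2).

Definition pauli_coord m : 'rV[C]_3 :=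
  row3 (im * (m o0 o1 + m o1 o0)) (m o1 o0 - m o0 o1) (im * (m o0 o0 - m o1 o1)).

Lemma tr2 m : \tr m = m o0 o0 + m o1 o1.
Proof. by rewrite /mxtrace sum2. Qed.

Lemma pauliK x : pauli_coord (pauli x) = x.
Proof. by apply: row3P; rewrite !mxE /= ?mxE /=; field: (im2 R). Qed.

Lemma pauli_coordK m : \tr m = 0 -> pauli (pauli_coord m) = m.
Proof.
rewrite tr2 => /eqP; rewrite addr_eq0 => /eqP h.
by apply: mx2P; rewrite !mxE /= ?mxE /= ?h; field: (im2 R).
Qed.

Lemma tr_pauli x : \tr (pauli x) = 0.
Proof. by rewrite tr2 !mxE /=; ring. Qed.

Lemma pauli_cross x y :
  pauli (cross x y) = pauli x *m pauli y - pauli y *m pauli x.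
Proof.
by apply: mx2P; rewrite !(mxE, sum2) /=; field: (im2 R).
Qed.

Lemma pauli_coordD m n : pauli_coord (m + n) = pauli_coord m + pauli_coord n.
Proof. by apply: row3P; rewrite !mxE /= ?mxE; ring. Qed.

Lemma pauli_coordZ c m : pauli_coord (c *: m) = c *: pauli_coord m.
Proof. by apply: row3P; rewrite !mxE /= ?mxE; ring. Qed.

Lemma pauli_coordN m : pauli_coord (- m) = - pauli_coord m.
Proof. by apply: row3P; rewrite !mxE /= ?mxE; ring. Qed.

Lemma pauliD x y : pauli (x + y) = pauli x + pauli y.
Proof. by apply: mx2P; rewrite !mxE /= ?mxE; ring. Qed.

Lemma pauliZ c x : pauli (c *: x) = c *: pauli x.
Proof. by apply: mx2P; rewrite !mxE /= ?mxE; ring. Qed.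

(** The adjugate: it agrees with the inverse on SL(2,C) but is linear in [m]. *)
Definition adj2 m : M := (\tr m)%:M - m.

Lemma det2 m : \det m = m o0 o0 * m o1 o1 - m o0 o1 * m o1 o0.
Proof.
rewrite (expand_det_row _ o0) sum2 /cofactor !det_mx11 !mxE /=.
pose a (i j : nat) := m (inord i) (inord j).
have aE i j : m i j = a i j by rewrite /a !inord_val.
by clearbody a; rewrite !aE /= /bump /=; ring.
Qed.

Lemma mul_adj2 m : adj2 m *m m = (\det m)%:M.
Proof.
rewrite det2 /adj2 tr2; apply: mx2P; rewrite !(mxE, sum2) /= ?(mulr1n, mulr0n); ring.
Qed.

Lemma mul_mx_adj2 m : m *m adj2 m = (\det m)%:M.
Proof.
rewrite det2 /adj2 tr2; apply: mx2P; rewrite !(mxE, sum2) /= ?(mulr1n, mulr0n); ring.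
Qed.

Lemma adj2M m n : adj2 (m *m n) = adj2 n *m adj2 m.
Proof.
rewrite /adj2 !tr2; apply: mx2P; rewrite !(mxE, sum2) /= ?(mulr1n, mulr0n); ring.
Qed.

Lemma adj2D m n : adj2 (m + n) = adj2 m + adj2 n.
Proof. by rewrite /adj2 mxtraceD raddfD opprD addrACA. Qed.

Lemma adj2Z c m : adj2 (c *: m) = c *: adj2 m.
Proof. by rewrite /adj2 mxtraceZ scalerBr scale_scalar_mx. Qed.

Lemma adj2_traceless m : \tr m = 0 -> adj2 m = - m.
Proof. by rewrite /adj2 => ->; rewrite -scalemx1 scale0r sub0r. Qed.

Lemma invmx_adj2 m : \det m = 1 -> invmx m = adj2 m.
Proof.
move=> d1; have u : m \in unitmx by rewrite unitmxE d1 unitr1.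
by rewrite -[LHS]mul1mx -d1 -mul_adj2 mulmxK.
Qed.

(* On tangent vectors [u = p x], [v = p y] of SL(2,C) this is [- [x, y]]; it is
   defined on all of M_2(C), and does not involve the base point. *)
Definition maurer_cartan m n : 'rV[C]_3 :=
  pauli_coord (adj2 m *m n - adj2 n *m m).

Lemma maurer_cartanDl m m' n :
  maurer_cartan (m + m') n = maurer_cartan m n + maurer_cartan m' n.
Proof.
by rewrite -pauli_coordD /maurer_cartan adj2D mulmxDl mulmxDr opprD addrACA.
Qed.

Lemma maurer_cartanZl c m n : maurer_cartan (c *: m) n = c *: maurer_cartan m n.
Proof.
by rewrite -pauli_coordZ /maurer_cartan adj2Z -scalemxAl -scalemxAr scalerBr.
Qed.

Lemma maurer_cartanC m n : maurer_cartan n m = - maurer_cartan m n.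
Proof. by rewrite -pauli_coordN /maurer_cartan opprB. Qed.

(** For [m = p x] with [x] traceless, [adj2 m = - x adj2 p]; the factor [adj2 p p = 1] cancels and
    the commutator [x y - y x] remains, with a minus sign. *)
Lemma maurer_cartan_tangent p m n : \det p = 1 ->
  \tr (adj2 p *m m) = 0 -> \tr (adj2 p *m n) = 0 ->
  maurer_cartan m n =
    - cross (pauli_coord (adj2 p *m m)) (pauli_coord (adj2 p *m n)).
Proof.
move=> d1; set x := adj2 p *m m; set y := adj2 p *m n => tx ty.
have mE (z : M) : z = p *m (adj2 p *m z) by rewrite mulmxA mul_mx_adj2 d1 mul1mx.
have mx : m = p *m x := mE m; have ny : n = p *m y := mE n.
clearbody x y; rewrite /maurer_cartan mx ny !adj2M -!mulmxA.
rewrite ![adj2 p *m (p *m _)]mulmxA mul_adj2 d1 !mul1mx.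
rewrite (adj2_traceless tx) (adj2_traceless ty) !mulNmx -opprD.
have xy : x *m y - y *m x = pauli (cross (pauli_coord x) (pauli_coord y)).
  by rewrite pauli_cross !pauli_coordK.
by rewrite xy pauli_coordN pauliK.
Qed.

(** The Binet-Cauchy identity: with [mulmx_dot], it writes the 2-form [z_f /\ z_g] of two
    coordinates as a linear function of the bracket [cross x y]. *)
Lemma dot_cross_cross x y z w :
  dot (cross x y) (cross z w) = dot x z * dot y w - dot y z * dot x w.
Proof. by rewrite /dot !mxE /=; ring. Qed.

Lemma mulmx_dot x (G : 'M[C]_3) k : (x *m G) 0 k = dot x (col k G)^T.
Proof. by rewrite mxE sum3 /dot !mxE. Qed.

End SL2.

(** * Smooth functions near SL(2,C) *)

Section Smoothness.
Variable R : realType.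
Local Notation V := (M2C R).

Lemma normc_ge_Im (z : R[i]) : `|complex.Im z|%:C <= `|z|.
Proof.
case: z => a b; rewrite normc_def lecR /= -sqrtr_sqr.
by rewrite ler_wsqrtr // lerDr sqr_ge0.
Qed.

Lemma continuous_Re : continuous (fun z : R[i]^o => complex.Re z : R^o).
Proof.
move=> z; apply/(@cvgrPdist_lt _ R^o _ _ (nbhs_filter (z : R[i]^o))) => e e0; apply/nbhs_ballP.
exists e%:C => [|w] /=; first by rewrite ltcR.
rewrite -ball_normE /= => zw; rewrite -ltcR; apply: le_lt_trans zw.
by have := normc_ge_Re (z - w); case: (z) => ? ?; case: (w).
Qed.

Lemma continuous_Im : continuous (fun z : R[i]^o => complex.Im z : R^o).
Proof.
move=> z; apply/(@cvgrPdist_lt _ R^o _ _ (nbhs_filter (z : R[i]^o))) => e e0; apply/nbhs_ballP.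
exists e%:C => [|w] /=; first by rewrite ltcR.
rewrite -ball_normE /= => zw; rewrite -ltcR; apply: le_lt_trans zw.
by have := normc_ge_Im (z - w); case: (z) => ? ?; case: (w).
Qed.

Lemma continuous_real_complex : continuous (fun t : R^o => t%:C : R[i]^o).
Proof.
move=> t; apply/cvgrPdist_lt => -[e e'].
(* Positivity in the order of [R[i]] forces the radius to be real. *)
rewrite ltcE /= => /andP[/eqP -> e0]; apply/nbhs_ballP.
exists e => // s /= ts.
by rewrite -rmorphB /= normc_def /= expr0n /= addr0 sqrtr_sqr ltcR.
Qed.

Lemma continuous_line (p v : V) : continuous (fun t : R^o => p + t%:C *: v).
Proof.
move=> t; apply: cvgD; first exact: cvg_cst.
apply: (@continuous_comp R^o R[i]^o V (fun t => t%:C) (fun c => c *: v)).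
  exact: continuous_real_complex.
exact: (@scalel_continuous _ V v).
Qed.

Lemma near_line (U : set V) p v : open U -> U p -> \forall t \near (0 : R^o), U (p + t%:C *: v).
Proof.
move=> oU Up; have := @continuous_line p v 0; apply.
by apply: open_nbhs_nbhs; split=> //; rewrite scale0r addr0.
Qed.

Implicit Types (U : set V) (f g : V -> R).

(** Short segments from a point of the open set [U] stay in [U], so derivatives only see values
    there. It is needed because the sum and product rules for [dirder] are available only at points
    of [U]. *)
Lemma class_C_eq n U f g : open U -> (forall p, U p -> f p = g p) ->
  class_C n U f -> class_C n U g.
Proof.
move=> oU fg.
have cont h k : (forall p, U p -> h p = k p) -> {in U, continuous h} ->
    {in U, continuous k}.
  move=> hk ch p Up; rewrite /continuous_at -hk; last by move: Up; rewrite inE.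
  have nU : nbhs p U by apply: open_nbhs_nbhs; split=> //; move: Up; rewrite inE.
  have hkp : \forall q \near p, h q = k q by apply: filterS nU => q; exact: hk.
  exact: cvg_trans (@near_eq_cvg _ _ _ (nbhs_filter p) _ _ hkp) (ch p Up).
elim: n f g fg => [|n IH] f g fg [cf df]; split; [exact: cont cf|by []|exact: cont cf|].
move=> v; have [dv Cv] := df v; split.
  move=> p Up; apply: near_eq_derivable (dv p Up).
  by apply: filterS (near_line v oU Up) => t; exact: fg.
apply: IH Cv => p Up; rewrite /dirder !derive1E; apply: near_eq_derive.
by apply: filterS (near_line v oU Up) => t; exact: fg.
Qed.

Lemma class_C_sub n U U' f : U' `<=` U -> class_C n U f -> class_C n U' f.
Proof.
elim: n U f => [|n IH] U f sU [cf df]; split=> //.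
- by move=> p; rewrite inE => /sU Up; apply: cf; rewrite inE.
- by move=> p; rewrite inE => /sU Up; apply: cf; rewrite inE.
move=> v; have [dv Cv] := df v; split; last exact: IH Cv.
by move=> p /sU; exact: dv.
Qed.

Lemma class_C_pred n U f : class_C n.+1 U f -> class_C n U f.
Proof.
elim: n f => [|n IH] f [cf df]; split=> // v.
by have [dv Cv] := df v; split=> //; exact: IH.
Qed.

Lemma dirder_cst (a : R) v p : dirder (fun=> a) v p = 0.
Proof. by rewrite /dirder derive1E derive_cst. Qed.

Lemma class_C_cst n U (a : R) : class_C n U (fun=> a).
Proof.
elim: n a => [|n IH] a; split=> //.
- by move=> p _; exact: (@cst_continuous V R a p).
- by move=> p _; exact: (@cst_continuous V R a p).
move=> v; split; first by move=> p _; exact: derivable_cst.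
rewrite (_ : dirder _ v = fun=> 0) //.
by apply/funext => p; exact: dirder_cst.
Qed.

Lemma class_CD n U f g : open U -> class_C n U f -> class_C n U g ->
  class_C n U (fun p => f p + g p).
Proof.
elim: n f g => [|n IH] f g oU [cf df] [cg dg]; split=> //.
- by move=> p Up; exact: (@cvgD _ R^o _ (nbhs p) _ f g (f p) (g p) (cf p Up) (cg p Up)).
- by move=> p Up; exact: (@cvgD _ R^o _ (nbhs p) _ f g (f p) (g p) (cf p Up) (cg p Up)).
move=> v; have [dfv Cf] := df v; have [dgv Cg] := dg v; split.
  by move=> p Up; apply: derivableD; [exact: dfv|exact: dgv].
apply: class_C_eq (IH _ _ oU Cf Cg) => // p Up.
by rewrite /dirder !derive1E deriveD; [|exact: dfv|exact: dgv].
Qed.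

Lemma class_CM n U f g : open U -> class_C n U f -> class_C n U g ->
  class_C n U (fun p => f p * g p).
Proof.
elim: n f g => [|n IH] f g oU hf hg.
  by case: hf => cf _; case: hg => cg _; split=> // p Up; exact: (@cvgM R _ (nbhs p) _ f g (f p) (g p) (cf p Up) (cg p Up)).
case: (hf) => cf df; case: (hg) => cg dg; split=> //.
  by move=> p Up; exact: (@cvgM R _ (nbhs p) _ f g (f p) (g p) (cf p Up) (cg p Up)).
move=> v; have [dfv Cf] := df v; have [dgv Cg] := dg v; split.
  by move=> p Up; apply: derivableM; [exact: dfv|exact: dgv].
apply: class_C_eq (class_CD oU (IH _ _ oU (class_C_pred hf) Cg)
  (IH _ _ oU (class_C_pred hg) Cf)) => // p Up.
rewrite /dirder !derive1E deriveM; [|exact: dfv|exact: dgv].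
by rewrite /along !scale0r !addr0.
Qed.


Lemma smooth_near_cst (a : R) : smooth_near (fun=> a).
Proof. by exists setT; split=> // [|n]; [exact: openT|exact: class_C_cst]. Qed.

Lemma smooth_nearD f g : smooth_near f -> smooth_near g ->
  smooth_near (fun p => f p + g p).
Proof.
move=> [U [oU sU cf]] [W [oW sW cg]]; exists (U `&` W); split.
- exact: openI.
- by move=> p Sp; split; [exact: sU|exact: sW].
- move=> n; apply: class_CD; first exact: openI.
  + by apply: class_C_sub (cf n) => p [].
  + by apply: class_C_sub (cg n) => p [].
Qed.

Lemma smooth_nearM f g : smooth_near f -> smooth_near g ->
  smooth_near (fun p => f p * g p).
Proof.
move=> [U [oU sU cf]] [W [oW sW cg]]; exists (U `&` W); split.
- exact: openI.
- by move=> p Sp; split; [exact: sU|exact: sW].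
- move=> n; apply: class_CM; first exact: openI.
  + by apply: class_C_sub (cf n) => p [].
  + by apply: class_C_sub (cg n) => p [].
Qed.

Lemma smooth_nearN f : smooth_near f -> smooth_near (fun p => - f p).
Proof.
move=> sf; rewrite (_ : (fun p => _) = fun p => -1 * f p).
  by apply: smooth_nearM => //; exact: smooth_near_cst.
by apply/funext => p; rewrite mulN1r.
Qed.

Lemma is_derive_along_linear f p v :
  (forall p q (t : R), f (p + t%:C *: q) = f p + t * f q) ->
  is_derive (0 : R) 1 (along f p v) (f v).
Proof.
move=> lf; have -> : along f p v = cst (f p) + f v \*: id.
  by apply/funext => t; rewrite /along lf /= mulrC.
have := is_deriveD (is_derive_cst (f p) (0 : R) 1)
  (is_deriveZ (f v) (is_derive_id (0 : R) 1)).
by rewrite add0r [_ *: _]mulr1.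
Qed.

Lemma dirder_linear f v p :
  (forall p q (t : R), f (p + t%:C *: q) = f p + t * f q) -> dirder f v p = f v.
Proof.
move=> lf; have := is_derive_along_linear p v lf.
by rewrite /dirder derive1E => d; rewrite derive_val.
Qed.

Lemma smooth_near_linear f : continuous f ->
  (forall p q (t : R), f (p + t%:C *: q) = f p + t * f q) -> smooth_near f.
Proof.
move=> cf lf; exists setT; split=> // [|n]; first exact: openT.
have cf' : {in setT, continuous f} by move=> p _; exact: cf.
case: n => [|n]; split=> // v; split=> [p _|].
  by have d := is_derive_along_linear p v lf; exact: ex_derive.
rewrite (_ : dirder f v = fun=> f v); first exact: class_C_cst.
by apply/funext => p; exact: dirder_linear.
Qed.

Definition smooth_complex (F : V -> R[i]) : Prop :=
  smooth_near (fun p => complex.Re (F p)) /\ smooth_near (fun p => complex.Im (F p)).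

Lemma smooth_complex_cst (c : R[i]) : smooth_complex (fun=> c).
Proof. by split; exact: smooth_near_cst. Qed.

Lemma smooth_complexD F G : smooth_complex F -> smooth_complex G ->
  smooth_complex (fun p => F p + G p).
Proof.
move=> [F1 F2] [G1 G2]; split.
- rewrite (_ : (fun p => _) = fun p => complex.Re (F p) + complex.Re (G p)).
    exact: smooth_nearD.
  by apply/funext => p; case: (F p) (G p) => ? ? [].
- rewrite (_ : (fun p => _) = fun p => complex.Im (F p) + complex.Im (G p)).
    exact: smooth_nearD.
  by apply/funext => p; case: (F p) (G p) => ? ? [].
Qed.

Lemma smooth_complexM F G : smooth_complex F -> smooth_complex G ->
  smooth_complex (fun p => F p * G p).
Proof.
move=> [F1 F2] [G1 G2]; split.
- rewrite (_ : (fun p => _) = fun p => complex.Re (F p) * complex.Re (G p)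
    + - (complex.Im (F p) * complex.Im (G p))).
    by apply: smooth_nearD; [|apply: smooth_nearN]; exact: smooth_nearM.
  by apply/funext => p; case: (F p) (G p) => ? ? [].
- rewrite (_ : (fun p => _) = fun p => complex.Re (F p) * complex.Im (G p)
    + complex.Im (F p) * complex.Re (G p)).
    by apply: smooth_nearD; exact: smooth_nearM.
  by apply/funext => p; case: (F p) (G p) => ? ? [].
Qed.

Lemma smooth_complex_conj F : smooth_complex F -> smooth_complex (fun p => conjc (F p)).
Proof.
move=> [F1 F2]; split.
- rewrite (_ : (fun p => _) = fun p => complex.Re (F p)) //.
  by apply/funext => p; case: (F p).
- rewrite (_ : (fun p => _) = fun p => - complex.Im (F p)); first exact: smooth_nearN.
  by apply/funext => p; case: (F p).
Qed.

Lemma smooth_complexN F : smooth_complex F -> smooth_complex (fun p => - F p).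
Proof.
move=> sF; rewrite (_ : (fun p => _) = fun p => -1 * F p).
  by apply: smooth_complexM => //; exact: smooth_complex_cst.
by apply/funext => p; rewrite mulN1r.
Qed.

Lemma smooth_complex_coord i j : smooth_complex (fun p => p i j).
Proof.
split; apply: smooth_near_linear.
- move=> p; apply: (@continuous_comp V R[i]^o R^o (fun q => q i j)).
    exact: coord_continuous.
  exact: continuous_Re.
- by move=> p q t; rewrite !mxE; case: (p i j) (q i j) => ? ? [? ?] /=; ring.
- move=> p; apply: (@continuous_comp V R[i]^o R^o (fun q => q i j)).
    exact: coord_continuous.
  exact: continuous_Im.
- by move=> p q t; rewrite !mxE; case: (p i j) (q i j) => ? ? [? ?] /=; ring.
Qed.

End Smoothness.

(** * Expansion of signed sums over permutations *)

Section PermutationSums.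
Variable R : pzRingType.

(** Permutations are sorted by the image [i] of [ord0], as in a Laplace expansion; iterating this
    makes the sums defining [wedge] explicit. *)
Lemma sum_perm_recl n (F : 'S_n.+1 -> R) :
  \sum_(s : 'S_n.+1) (-1) ^+ s * F s =
  \sum_(i < n.+1) (-1) ^+ i *
    \sum_(t : 'S_n) (-1) ^+ t * F (lift_perm ord0 i t).
Proof.
rewrite (partition_big (fun s : 'S_n.+1 => s ord0) predT) //=.
apply: eq_bigr => i _; rewrite (reindex (lift_perm ord0 i)); last first.
  (* [ulsf j s] is [s] with [j] and its image removed, the default [k] never being reached; at
     [j = ord0] it inverts [lift_perm ord0 i]. *)
  pose ulsf j (s : 'S_n.+1) k := odflt k (unlift (s j) (s (lift j k))).
  have ulsfK j (s : 'S_n.+1) k : lift (s j) (ulsf j s k) = s (lift j k).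
    rewrite /ulsf; have := neq_lift j k.
    by rewrite -(can_eq (permK s)) => /unlift_some[] ? ? ->.
  have inj_ulsf : injective (ulsf ord0 _).
    move=> s; apply: can_inj (ulsf (s ord0) s^-1%g) _ => k'.
    by rewrite {1}/ulsf ulsfK !permK liftK.
  exists (fun s => perm (inj_ulsf s)) => [s _ | s].
    by apply/permP=> k'; rewrite permE /ulsf lift_perm_lift lift_perm_id liftK.
  move/(s _ =P _) => si0; apply/permP=> k.
  case: (unliftP ord0 k) => [k'|] ->; rewrite ?lift_perm_id //.
  by rewrite lift_perm_lift -si0 permE ulsfK.
rewrite big_distrr; apply: eq_big => [t|t _]; first by rewrite lift_perm_id eqxx.
rewrite /= mulrA odd_lift_perm /= signr_addb.
by rewrite signr_odd.
Qed.

Lemma sum_perm0 (F : 'S_0 -> R) : \sum_(s : 'S_0) (-1) ^+ s * F s = F 1%g.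
Proof.
rewrite (big_pred1 1%g) => [|s]; first by rewrite odd_perm1 mul1r.
by apply/esym/eqP/permP; case.
Qed.

End PermutationSums.

(** * The square of a 2-form as a Pfaffian *)

Section WedgeSquare.
Variable R : realType.
Local Notation V := (M2C R).

(** The power ends with a wedge by the constant 1, whose factor [1/2!] is compensated by two equal
    terms. *)
Lemma wedge_pow1 (f : V -> V -> V -> R) p (v : 'I_2 -> V) :
  (forall i j, f p (v i) (v j) = - f p (v j) (v i)) ->
  wedge_pow (fun q w => f q (w ord0) (w ord_max)) 1 p v = f p (v ord0) (v ord_max).
Proof.
move=> anti; rewrite /= /wedge.
transitivity ((2%:R)^-1 * \sum_(s : 'S_2) (-1) ^+ s * f p (v (s ord0)) (v (s ord_max)) : R).
  congr (_ * _).
  apply: eq_bigr => s _; rewrite mulr1; congr (_ * f p (v (s _)) (v (s _)));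
    exact: val_inj.
have -> : @ord_max 1 = lift ord0 ord0 by apply: val_inj.
rewrite sum_perm_recl !big_ord_recl big_ord0 /= !sum_perm_recl !big_ord_recl.
rewrite !big_ord0 /= !sum_perm0 !lift_perm_lift !lift_perm_id.
have -> : lift (lift ord0 ord0) ord0 = ord0 :> 'I_2 by apply: val_inj.
by rewrite [f p (v (lift ord0 ord0)) _]anti; field.
Qed.

(** The 24 permutations give three pairings of the arguments, each occurring 8 times with the same
    value, against the normalising factor 1/4. *)
Lemma wedge_pow2 (f : V -> V -> V -> R) p (v : 'I_4 -> V) (w : 'I_4 -> 'I_4 -> R) :
  (forall i j, f p (v i) (v j) = w i j) ->
  (forall i j, w i j = - w j i) ->
  let o k := inord k : 'I_4 in
  wedge_pow (fun q w => f q (w ord0) (w ord_max)) 2 p v =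
  2 * (w (o 0) (o 1) * w (o 2) (o 3) - w (o 0) (o 2) * w (o 1) (o 3)
       + w (o 0) (o 3) * w (o 1) (o 2)).
Proof.
move=> fw anti o.
transitivity ((4%:R)^-1 * \sum_(s : 'S_4) (-1) ^+ s *
   (w (s ord0) (s (lift ord0 ord0)) * w (s (lift ord0 (lift ord0 ord0)))
     (s (lift ord0 (lift ord0 (lift ord0 ord0))))) : R).
  set W := fun q u => f q (u ord0) (u ord_max).
  rewrite -[wedge_pow W 2]/(wedge W (wedge_pow W 1)) /wedge /W.
  congr (_ * _).
  apply: eq_bigr => s _; congr (_ * (_ * _)).
    by rewrite fw; congr (w (s _) (s _)); exact: val_inj.
  rewrite wedge_pow1 => [|i j]; last by rewrite !fw.
  by rewrite fw; congr (w (s _) (s _)); exact: val_inj.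
pose g (i j : nat) := w (inord i) (inord j).
have gE i j : w i j = g i j by rewrite /g !inord_val.
have ganti i j : g i j = - g j i by exact: anti.
rewrite sum_perm_recl !big_ord_recl big_ord0 /= !sum_perm_recl !big_ord_recl.
rewrite !big_ord0 /= !sum_perm_recl !big_ord_recl !big_ord0 /= !sum_perm_recl.
rewrite !big_ord_recl !big_ord0 /= !sum_perm0 !lift_perm_lift !lift_perm_id.
rewrite !gE /o !inordK //= /bump /=.
rewrite !addn0 !add0n -[(1 + 1)%N]/2%N -[(1 + 2)%N]/3%N.
rewrite (ganti 1 0)%N (ganti 2 0)%N (ganti 3 0)%N (ganti 2 1)%N (ganti 3 1)%N (ganti 3 2)%N.
by field.
Qed.

End WedgeSquare.

(** * Reduction of a left-invariant structure to the Lie algebra *)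

Section LeftInvariant.
Variable R : realType.
Local Notation V := (M2C R).
Local Notation C := R[i].
Variable J : V -> V -> V.
Hypothesis liJ : left_invariant_complex_structure J.

Let acJ : almost_complex J. Proof. by case: liJ. Qed.

Lemma SL2_1 : SL2 (1%:M : V).
Proof. exact: det1. Qed.

Lemma tangentE (p u : V) : SL2 p -> tangent p u <-> \tr (adj2 p *m u : 'M[C]_2) = 0.
Proof. by move=> Sp; rewrite /tangent /= invmx_adj2. Qed.

Lemma tangent1E (u : V) : tangent 1%:M u <-> \tr (u : 'M[C]_2) = 0.
Proof. by rewrite /tangent /= invmx1 mul1mx. Qed.

Definition J_id (x : 'rV[C]_3) : 'rV[C]_3 := pauli_coord (J 1%:M (pauli x)).

Lemma tangent_pauli (x : 'rV[C]_3) : tangent (1%:M : V) (pauli x).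
Proof. by apply/tangent1E; exact: tr_pauli. Qed.

Lemma pauli_J_id x : pauli (J_id x) = J 1%:M (pauli x).
Proof.
apply: pauli_coordK; apply/tangent1E.
by apply: (ac_tangent acJ); [exact: SL2_1|exact: tangent_pauli].
Qed.

Lemma J_translate (p : V) x : SL2 p -> J p (p *m pauli x) = p *m pauli (J_id x).
Proof.
move=> Sp; case: liJ => _ _ inv.
by rewrite -{1}[p]mulmx1 inv ?pauli_J_id //; [exact: SL2_1|exact: tangent_pauli].
Qed.

Definition left_field (x : 'rV[C]_3) (p : V) : V := p *m pauli x.

Lemma smooth_complex_sum n (F : 'I_n -> V -> C) :
  (forall k, smooth_complex (F k)) -> smooth_complex (fun p => \sum_(k < n) F k p).
Proof.
elim: n F => [|n IH] F sF.
  rewrite (_ : (fun p => _) = fun=> 0); first exact: smooth_complex_cst.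
  by apply/funext => p; rewrite big_ord0.
rewrite (_ : (fun p => _) =
    fun p => (\sum_(k < n) F (widen_ord (leqnSn n) k) p) + F ord_max p).
  by apply: smooth_complexD => //; apply: IH => k.
by apply/funext => p; rewrite big_ord_recr.
Qed.

Lemma vector_field_left x : vector_field (left_field x).
Proof.
split=> [p Sp|i j].
  rewrite /tangent /left_field /= mulKmx; first exact: tr_pauli.
  by rewrite unitmxE Sp unitr1.
rewrite (_ : left_field x = fun q => \matrix_(i, j) \sum_k (q i k * pauli x k j)).
  have := @smooth_complex_sum 2 (fun k q => q i k * pauli x k j).
  move=> /(_ _)[k|s1 s2].
    apply: smooth_complexM; [exact: smooth_complex_coord|exact: smooth_complex_cst].
  split.
  - rewrite (_ : (fun q => _) = (fun q : V => complex.Re (\sum_(k < 2) q i k * pauli x k j))) //.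
    by apply/funext => q; rewrite mxE.
  - rewrite (_ : (fun q => _) = (fun q : V => complex.Im (\sum_(k < 2) q i k * pauli x k j))) //.
    by apply/funext => q; rewrite mxE.
by apply/funext => q; apply/matrixP => a b; rewrite !mxE.
Qed.

Lemma matrix_dirder_left x (v p : V) :
  matrix_dirder (left_field x) v p = v *m pauli x.
Proof.
have lin (a : C) (b : C) (t : R) : complex.Re (a + t%:C * b) = complex.Re a + t * complex.Re b
    /\ complex.Im (a + t%:C * b) = complex.Im a + t * complex.Im b.
  by case: a b => [? ?] [? ?] /=; split; ring.
apply/matrixP => i j; rewrite mxE !dirder_linear.
- by case: ((v *m pauli x) i j).
- by move=> q w t; rewrite /left_field mulmxDl -scalemxAl !mxE (lin _ _ t).2.
- by move=> q w t; rewrite /left_field mulmxDl -scalemxAl !mxE (lin _ _ t).1.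
Qed.

Lemma bracket_left x y : bracket (left_field x) (left_field y) 1%:M = pauli (cross x y).
Proof.
by rewrite /bracket !matrix_dirder_left /left_field !mul1mx pauli_cross.
Qed.

(** Integrability is tested on the fields [left_field]: [J] sends them to one another through
    [J_id], and their bracket at the identity is the cross product. *)
Lemma complex_structure_J_id : complex_structure J_id.
Proof.
have S1 := SL2_1; split.
- split=> [x y|a x].
    have := ac_linear acJ 1 S1 (tangent_pauli x) (tangent_pauli y).
    by rewrite !scale1r /J_id pauliD => ->; rewrite pauli_coordD.
  have := ac_linear acJ a S1 (tangent_pauli x) (tangent_pauli 0).
  have J0 : J 1%:M (pauli 0) = 0.
    have := ac_linear acJ 1 S1 (tangent_pauli 0) (tangent_pauli 0).
    rewrite !scale1r -pauliD addr0 => /eqP.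
    by rewrite -subr_eq0 opprD addrA subrr sub0r oppr_eq0 => /eqP.
  rewrite J0 addr0 => e; rewrite /J_id pauliZ -pauli_coordZ -e.
  by rewrite (_ : pauli 0 = 0) ?addr0 // -(scale0r 0) pauliZ !scale0r.
- move=> x; rewrite /J_id -/(J_id x) pauli_J_id (ac_square acJ) //; last exact: tangent_pauli.
  by rewrite pauli_coordN pauliK.
- move=> x y; case: liJ => _ intJ _.
  have := intJ _ _ _ _ (vector_field_left x) (vector_field_left y)
    (vector_field_left (J_id x)) (vector_field_left (J_id y)).
  have JX z p : SL2 p -> left_field (J_id z) p = J p (left_field z p).
    by move=> Sp; rewrite /left_field J_translate.
  move=> /(_ (JX x) (JX y) _ S1).
  rewrite (bracket_left x y) (bracket_left (J_id x) y) (bracket_left x (J_id y)).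
  rewrite (bracket_left (J_id x) (J_id y)) => /(congr1 (@pauli_coord R)).
  rewrite !(pauli_coordD, pauli_coordN) !pauliK -!/(J_id _) => ->.
  by apply: row3P; rewrite !mxE /= ?mxE; ring.
Qed.

End LeftInvariant.

(** * The left-invariant metric and the square of its form *)

Section Metric.
Variable R : realType.
Local Notation V := (M2C R).
Local Notation C := R[i].
Variables (G : 'M[C]_3) (a b : 'I_3 -> C).

Local Notation j k := (line_map (a k) (b k)).

Definition left_coord (p u : V) : 'rV[C]_3 := pauli_coord (adj2 p *m u : 'M[C]_2) *m G.

(** This is [w(u, J v)] for [w = sum_k s_k (i/2) z_k /\ conj z_k], with [J] acting on the k-th
    coordinate by [j k]. *)
Definition left_metric (p u v : V) : R :=
  \sum_(k < 3) orientation (a k) *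
    area (left_coord p u 0 k) (j k (left_coord p v 0 k)).

(** Half of [P /\ conj P] for alternating [P]: three of the six shuffles, the others being their
    conjugates. *)
Definition wedge_conj (P : V -> V -> C) (v0 v1 v2 v3 : V) : R :=
  complex.Re (P v0 v1 * conjc (P v2 v3) - P v0 v2 * conjc (P v1 v3)
    + P v0 v3 * conjc (P v1 v2)).

(** On vectors tangent to SL(2,C) this is the opposite of [z_f /\ z_g]; the sign cancels in
    [wedge_conj]. *)
Definition coord_form f g (m n : V) : C :=
  dot (maurer_cartan (m : 'M[C]_2) n) (cross (col f G)^T (col g G)^T).

Definition wedge_form (P : V -> V -> C) (v : 'I_4 -> V) : R :=
  wedge_conj P (v (inord 0)) (v (inord 1)) (v (inord 2)) (v (inord 3)).

(** The extension of [w /\ w] to M_2(C) with constant coefficients. *)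
Definition square_form (v : 'I_4 -> V) : R :=
  let s f := orientation (a f) in
  s e0 * s e1 * wedge_form (coord_form e0 e1) v
  + s e0 * s e2 * wedge_form (coord_form e0 e2) v
  + s e1 * s e2 * wedge_form (coord_form e1 e2) v.

Lemma coord_form_linear f g (r : R) (u w x : V) :
  coord_form f g (r%:C *: u + w) x = r%:C * coord_form f g u x + coord_form f g w x.
Proof. by rewrite /coord_form maurer_cartanDl maurer_cartanZl dotDl dotZl. Qed.

Lemma coord_formC f g (u w : V) : coord_form f g w u = - coord_form f g u w.
Proof. by rewrite /coord_form maurer_cartanC dotNl. Qed.

Lemma left_coord_linear p (r : R) u v :
  left_coord p (r%:C *: u + v) = r%:C *: left_coord p u + left_coord p v.
Proof.
by rewrite /left_coord mulmxDr -scalemxAr pauli_coordD pauli_coordZ mulmxDl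
  -scalemxAl.
Qed.

Lemma left_metric_linear p (r : R) u v w :
  left_metric p (r%:C *: u + v) w = r * left_metric p u w + left_metric p v w.
Proof.
rewrite /left_metric left_coord_linear !sum3 !mxE.
have area_lin x y z : area (r%:C * x + y) z = r * area x z + area y z.
  by rewrite /area; case: x y z => [? ?] [? ?] [? ?] /=; ring.
by rewrite !area_lin; ring.
Qed.

Definition smooth_mx m n (F : V -> 'M[C]_(m, n)) : Prop :=
  forall i k, smooth_complex (fun p => F p i k).

Lemma smooth_mx_mul m n l (F : V -> 'M[C]_(m, n)) (H : V -> 'M[C]_(n, l)) :
  smooth_mx F -> smooth_mx H -> smooth_mx (fun p => F p *m H p).
Proof.
move=> sF sH i k; rewrite (_ : (fun p => _) = fun p => \sum_(h < n) (F p i h * H p h k)).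
  by apply: smooth_complex_sum => h; exact: smooth_complexM.
by apply/funext => p; rewrite mxE.
Qed.

Lemma smooth_mx_adj2 (F : V -> 'M[C]_2) :
  smooth_mx F -> smooth_mx (fun p => adj2 (F p)).
Proof.
move=> sF i k.
rewrite (_ : (fun p => _) = fun p => (F p o0 o0 + F p o1 o1) * (i == k)%:R + - F p i k).
  apply: smooth_complexD; last exact: smooth_complexN.
  by apply: smooth_complexM; [exact: smooth_complexD|exact: smooth_complex_cst].
by apply/funext => p; rewrite /adj2 tr2 !mxE mulr_natr.
Qed.

Lemma smooth_mx_pauli_coord (F : V -> 'M[C]_2) :
  smooth_mx F -> smooth_mx (fun p => pauli_coord (F p)).
Proof.
move=> sF i; apply: ord3P.
- rewrite (_ : (fun p => _) = fun p => im * (F p o0 o1 + F p o1 o0)).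
    by apply: smooth_complexM; [exact: smooth_complex_cst|exact: smooth_complexD].
  by apply/funext => p; rewrite mxE.
- rewrite (_ : (fun p => _) = fun p => F p o1 o0 + - F p o0 o1).
    by apply: smooth_complexD => //; exact: smooth_complexN.
  by apply/funext => p; rewrite mxE.
- rewrite (_ : (fun p => _) = fun p => im * (F p o0 o0 + - F p o1 o1)).
    apply: smooth_complexM; [exact: smooth_complex_cst|apply: smooth_complexD => //].
    exact: smooth_complexN.
  by apply/funext => p; rewrite mxE.
Qed.

Lemma smooth_left_coord (X : V -> V) : smooth_mx X ->
  smooth_mx (fun p => left_coord p (X p)).
Proof.
move=> sX; apply: smooth_mx_mul; last by move=> i k; exact: smooth_complex_cst.
apply: smooth_mx_pauli_coord; apply: smooth_mx_mul => //.
apply: (@smooth_mx_adj2 (fun p => p)).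
by move=> i k; exact: smooth_complex_coord.
Qed.

Lemma smooth_left_metric X Y : vector_field X -> vector_field Y ->
  smooth_SL2 (fun p => left_metric p (X p) (Y p)).
Proof.
move=> [_ sX] [_ sY]; eexists; last by [].
pose F p := \sum_(k < 3) (orientation (a k))%:C *
   (conjc (left_coord p (X p) 0 k) * j k (left_coord p (Y p) 0 k)).
rewrite (_ : (fun p => _) = fun p => complex.Im (F p)); last first.
  apply/funext => p; rewrite /left_metric /F !sum3 /area.
  have ImD (x y : C) : complex.Im (x + y) = complex.Im x + complex.Im y.
    by case: x y => [? ?] [].
  have ImZ (r : R) (x : C) : complex.Im (r%:C * x) = r * complex.Im x.
    by case: x => ? ? /=; ring.
  by rewrite !ImD !ImZ.
suff [] : smooth_complex F by [].
have cX := smooth_left_coord sX; have cY := smooth_left_coord sY.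
apply: smooth_complex_sum => k; apply: smooth_complexM.
  exact: smooth_complex_cst.
apply: smooth_complexM; first exact: smooth_complex_conj.
apply: smooth_complexD; apply: smooth_complexM; try exact: smooth_complex_cst.
  exact: cY.
by apply: smooth_complex_conj; exact: cY.
Qed.

Lemma left_metric_translate (g p u v : V) : SL2 g ->
  left_metric (g *m p) (g *m u) (g *m v) = left_metric p u v.
Proof.
move=> Sg; have E w : left_coord (g *m p) (g *m w) = left_coord p w.
  rewrite /left_coord (_ : adj2 (g *m p) *m (g *m w) = adj2 p *m w) //.
  by rewrite adj2M -mulmxA [adj2 g *m _]mulmxA mul_adj2 Sg mul1mx.
by rewrite /left_metric !E.
Qed.

(** * Multilinear and alternating properties of the wedge of a 2-form with its conjugate *)

Section WedgeConj.
Variable P : V -> V -> C.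
Hypothesis P_linear : forall (r : R) (u w x : V), P (r%:C *: u + w) x = r%:C * P u x + P w x.
Hypothesis PC : forall u w : V, P w u = - P u w.

Lemma wedge_conj_linear0 (r : R) (u w v1 v2 v3 : V) :
  wedge_conj P (r%:C *: u + w) v1 v2 v3 =
  r * wedge_conj P u v1 v2 v3 + wedge_conj P w v1 v2 v3.
Proof.
rewrite /wedge_conj !P_linear; case: (P u v1) (P w v1) (P u v2) (P w v2) => [? ?].
move=> [? ?] [? ?] [? ?]; case: (P u v3) (P w v3) (P v2 v3) (P v1 v3) => [? ?].
by move=> [? ?] [? ?] [? ?]; case: (P v1 v2) => [? ?] /=; ring.
Qed.

Lemma wedge_conj_swap01 v0 v1 v2 v3 :
  wedge_conj P v1 v0 v2 v3 = - wedge_conj P v0 v1 v2 v3.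
Proof.
rewrite /wedge_conj (PC v0 v1); case: (P v0 v1) (P v0 v2) (P v0 v3) => [? ?] [? ?].
by move=> [? ?]; case: (P v1 v2) (P v1 v3) (P v2 v3) => [? ?] [? ?] [? ?] /=; ring.
Qed.

Lemma wedge_conj_swap12 v0 v1 v2 v3 :
  wedge_conj P v0 v2 v1 v3 = - wedge_conj P v0 v1 v2 v3.
Proof.
rewrite /wedge_conj (PC v1 v2); case: (P v0 v1) (P v0 v2) (P v0 v3) => [? ?] [? ?].
by move=> [? ?]; case: (P v1 v2) (P v1 v3) (P v2 v3) => [? ?] [? ?] [? ?] /=; ring.
Qed.

Lemma wedge_conj_swap23 v0 v1 v2 v3 :
  wedge_conj P v0 v1 v3 v2 = - wedge_conj P v0 v1 v2 v3.
Proof.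
rewrite /wedge_conj (PC v2 v3); case: (P v0 v1) (P v0 v2) (P v0 v3) => [? ?] [? ?].
by move=> [? ?]; case: (P v1 v2) (P v1 v3) (P v2 v3) => [? ?] [? ?] [? ?] /=; ring.
Qed.

Lemma wedge_conj_diag01 u v2 v3 : wedge_conj P u u v2 v3 = 0.
Proof. by have := wedge_conj_swap01 u u v2 v3; lra. Qed.

Lemma wedge_conj_diag12 u v0 v3 : wedge_conj P v0 u u v3 = 0.
Proof. by have := wedge_conj_swap12 v0 u u v3; lra. Qed.

Lemma wedge_conj_diag23 u v0 v1 : wedge_conj P v0 v1 u u = 0.
Proof. by have := wedge_conj_swap23 v0 v1 u u; lra. Qed.

(** Adjacent transpositions bring any argument to the first place, where linearity is inherited from
    [P]. *)
Lemma wedge_form_multilinear : multilinear (wedge_form P).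
Proof.
move=> v i r u w; pose o (x : 'I_4 -> V) k := x (inord k).
rewrite /wedge_form -!/(o _ _).
have E m t : (m < 4)%N -> o (setarg v i t) m = if m == i :> nat then t else o v m.
  by move=> m4; rewrite /o /setarg -val_eqE /= inordK.
rewrite !E //; case: i {E} => [[|[|[|[|//]]]] hi] /=.
- exact: wedge_conj_linear0.
- rewrite ![wedge_conj P (o v 0) _ _ _]wedge_conj_swap01.
  by rewrite wedge_conj_linear0; ring.
- rewrite ![wedge_conj P _ (o v 1) _ _]wedge_conj_swap12.
  rewrite ![wedge_conj P (o v 0) _ _ _]wedge_conj_swap01.
  by rewrite wedge_conj_linear0; ring.
- rewrite ![wedge_conj P _ _ (o v 2) _]wedge_conj_swap23.
  rewrite ![wedge_conj P _ (o v 1) _ _]wedge_conj_swap12.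
  rewrite ![wedge_conj P (o v 0) _ _ _]wedge_conj_swap01.
  by rewrite wedge_conj_linear0; ring.
Qed.

(** Adjacent transpositions bring two equal arguments next to each other, where the value is its own
    opposite. *)
Lemma wedge_form_alternating : Defs.alternating (wedge_form P).
Proof.
pose o (x : 'I_4 -> V) k := x (inord k).
move=> v i k; wlog ik : i k / (i < k)%N => [H|_ vik].
  move=> nik vik; have /orP[] : (i < k)%N || (k < i)%N by rewrite -neq_ltn.
    by move=> ik; exact: (H i k).
  by move=> ki; apply: (H k i); rewrite // eq_sym.
have {}vik : o v i = o v k by rewrite /o !inord_val.
case: i k ik vik => [[|[|[|[|//]]]] hi] [[|[|[|[|//]]]] hk] //= _ vv;
  rewrite /wedge_form -!/(o _ _) vv.
- by rewrite wedge_conj_diag01.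
- by rewrite wedge_conj_swap12 wedge_conj_diag01 oppr0.
- by rewrite wedge_conj_swap23 wedge_conj_swap12 wedge_conj_diag01 !oppr0.
- by rewrite wedge_conj_diag12.
- by rewrite wedge_conj_swap23 wedge_conj_diag12 oppr0.
- by rewrite wedge_conj_diag23.
Qed.

End WedgeConj.

Lemma multilinear_comb3 (F1 F2 F3 : ('I_4 -> V) -> R) (c1 c2 c3 : R) :
  multilinear F1 -> multilinear F2 -> multilinear F3 ->
  multilinear (fun v => c1 * F1 v + c2 * F2 v + c3 * F3 v).
Proof. by move=> L1 L2 L3 v i r u w; rewrite L1 L2 L3; ring. Qed.

Lemma alternating_comb3 (F1 F2 F3 : ('I_4 -> V) -> R) (c1 c2 c3 : R) :
  Defs.alternating F1 -> Defs.alternating F2 -> Defs.alternating F3 ->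
  Defs.alternating (fun v => c1 * F1 v + c2 * F2 v + c3 * F3 v).
Proof.
move=> L1 L2 L3 v i k ik vik.
by rewrite (L1 _ _ _ ik vik) (L2 _ _ _ ik vik) (L3 _ _ _ ik vik) !mulr0 !addr0.
Qed.

Lemma smooth_square_form : smooth_form_near (fun _ : V => square_form).
Proof.
have L f g := wedge_form_multilinear (@coord_form_linear f g) (@coord_formC f g).
have A f g := wedge_form_alternating (@coord_formC f g).
exists setT; split => //.
- exact: openT.
- move=> p _; split; rewrite /square_form.
  + exact: multilinear_comb3 (L e0 e1) (L e0 e2) (L e1 e2).
  + exact: alternating_comb3 (A e0 e1) (A e0 e2) (A e1 e2).
- by move=> v n; exact: class_C_cst.
Qed.

Lemma ext_d_square_form (p : V) v : ext_d (fun _ : V => square_form) p v = 0.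
Proof. by rewrite /ext_d big1 // => i _; rewrite dirder_cst mulr0. Qed.

(** * Compatibility with the complex structure, and the balanced condition *)

Section Hermitian.
Variable J : V -> V -> V.
Hypothesis liJ : left_invariant_complex_structure J.
Hypothesis uG : G \in unitmx.
Hypothesis JG : forall x k, (J_id J x *m G) 0 k = j k ((x *m G) 0 k).
Hypothesis jj : forall k c, j k (j k c) = - c.

(** Left invariance brings [J p] back to [J_id], which [JG] splits along the coordinates. *)
Lemma left_coord_J p u k : SL2 p -> tangent p u ->
  left_coord p (J p u) 0 k = j k (left_coord p u 0 k).
Proof.
move=> Sp /(tangentE _ Sp) tu; rewrite -JG /left_coord.
have -> : J p u = p *m pauli (J_id J (pauli_coord (adj2 p *m u : 'M[C]_2))).
  rewrite -J_translate // pauli_coordK //.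
  by rewrite mulmxA mul_mx_adj2 Sp mul1mx.
congr ((_ *m G) 0 k); rewrite -[RHS]pauliK; congr pauli_coord.
by rewrite mulmxA mul_adj2 Sp mul1mx.
Qed.

Lemma left_coord_eq0 p u : SL2 p -> tangent p u -> left_coord p u = 0 -> u = 0.
Proof.
move=> Sp /(tangentE _ Sp) tu h.
have h0 : pauli_coord (adj2 p *m u : 'M[C]_2) = 0.
  by rewrite -[LHS](mulmxK uG) -/(left_coord p u) h mul0mx.
have : adj2 p *m u = 0 :> 'M[C]_2.
  by rewrite -(pauli_coordK tu) h0 -(scale0r 0) pauliZ scale0r.
move=> /(congr1 (mulmx (p : 'M[C]_2))); rewrite mulmx0 mulmxA mul_mx_adj2 Sp.
by rewrite mul1mx.
Qed.

Lemma left_metric_hermitian (Gamma : subgroup_SL2 R) :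
  hermitian_metric Gamma J left_metric.
Proof.
split.
- by move=> *; exact: left_metric_linear.
- move=> p u v _ _ _; rewrite /left_metric; apply: eq_bigr => k _.
  by rewrite area_line_map_sym.
- move=> p u Sp tu u0.
  have ge0 k : 0 <= orientation (a k) *
      area (left_coord p u 0 k) (j k (left_coord p u 0 k)).
    have [->|nz] := eqVneq (left_coord p u 0 k) 0; last exact/ltW/area_gt0.
    by rewrite /area conjc0 mul0r mulr0.
  have /nz_coord[k nz] : left_coord p u != 0.
    by apply: contra_neq u0; exact: left_coord_eq0.
  rewrite /left_metric (bigD1 k) //= ltr_pwDl ?sumr_ge0 //.
  exact: area_gt0.
- exact: smooth_left_metric.
- move=> g p u v Gg _ _ _; apply: left_metric_translate.
  exact: subgroup_sub Gg.
- move=> p u v Sp tu tv; rewrite /left_metric; apply: eq_bigr => k _.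
  by rewrite !left_coord_J // area_line_map.
Qed.

Lemma wedge_formE (P : V -> V -> C) (v : 'I_4 -> V) (z : 'I_4 -> 'rV[C]_3) f g :
  (forall i k, P (v i) (v k) = - (z i 0 f * z k 0 g - z k 0 f * z i 0 g)) ->
  let Phi i k := z i 0 f * z k 0 g - z k 0 f * z i 0 g in
  let o k := inord k : 'I_4 in
  wedge_form P v = complex.Re (Phi (o 0) (o 1) * conjc (Phi (o 2) (o 3))
    - Phi (o 0) (o 2) * conjc (Phi (o 1) (o 3))
    + Phi (o 0) (o 3) * conjc (Phi (o 1) (o 2))).
Proof.
move=> PE Phi o; have sgn (x y : C) : - x * conjc (- y) = x * conjc y.
  by rewrite rmorphN mulrNN.
by rewrite /wedge_form /wedge_conj !PE !sgn.
Qed.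

(** [wedge_pow2] and [pfaffian_sum] leave only the mixed products of coordinates, and each of these
    is the [wedge_form] of a [coord_form]. *)
Lemma square_formE p v : SL2 p -> (forall i, tangent p (v i)) ->
  square_form v = wedge_pow (fundamental_form J left_metric) 2 p v.
Proof.
move=> Sp tv.
pose w i k := \sum_(h < 3) orientation (a h) *
  area (left_coord p (v i) 0 h) (left_coord p (v k) 0 h).
rewrite (@wedge_pow2 _ (fun p u v => left_metric p (J p u) v) p v w).
- rewrite (pfaffian_sum (fun i => left_coord p (v i)) (fun h => orientation (a h))).
  have formE f g i k : coord_form f g (v i) (v k) =
      - (left_coord p (v i) 0 f * left_coord p (v k) 0 g
         - left_coord p (v k) 0 f * left_coord p (v i) 0 g).
    rewrite /coord_form (@maurer_cartan_tangent _ p) //; try exact/tangentE.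
    by rewrite dotNl dot_cross_cross -!mulmx_dot.
  have Q f g := wedge_formE (formE f g).
  have comb (c1 c2 c3 x1 x2 x3 y1 y2 y3 : R) : x1 = y1 -> x2 = y2 -> x3 = y3 ->
      c1 * x1 + c2 * x2 + c3 * x3 = c1 * y1 + c2 * y2 + c3 * y3.
    by move=> -> -> ->.
  exact: comb (Q e0 e1) (Q e0 e2) (Q e1 e2).
(* [J] disappears from the fundamental form because each [line_map] preserves [area]. *)
- move=> i k; apply: eq_bigr => h _.
  by rewrite left_coord_J // area_line_map.
- move=> i k; rewrite /w -sumrN; apply: eq_bigr => h _.
  by rewrite areaC mulrN.
Qed.

End Hermitian.
End Metric.

Theorem theorem1p2 (R : realType) (J : M2C R -> M2C R -> M2C R)
    (Gamma : subgroup_SL2 R) :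
  left_invariant_complex_structure J ->
  cocompact_lattice Gamma ->
  exists h : M2C R -> M2C R -> M2C R -> R, balanced_metric Gamma J h.
Proof.
move=> liJ _; have [G [a [b [uG JG jj]]]] := normal_form (complex_structure_J_id liJ).
exists (left_metric G a b); split; first exact: left_metric_hermitian.
(* The extension asked for by [closed_SL2] is the same alternating form at every point of M_2(C). *)
exists (fun _ => square_form G a); split.
- exact: smooth_square_form.
- by move=> p v Sp tv; exact: square_formE.
- by move=> p v _ _; exact: ext_d_square_form.
Qed.
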